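(* Let $\boldsymbol v=(v_1,\ldots,v_k)$ be a $k$-tuple of positive integers and let $p,x$ be real numbers with $p\ge1$ and $x+1>0$. The function $s\mapsto\mathcal Z^{\boldsymbol v}_p(s;x)$, defined for $\Re(s)>1-k$, can be analytically continued to the whole $s$-plane as an entire function, and its values at non-positive integers are given by $$\mathcal Z^{\boldsymbol v}_p(-m;x)=(-1)^mB_{p,m}^{\boldsymbol v}(-x)\qquad(m=0,1,2,\ldots).$$
   Context: For $\Re(s)>1-k$, $$\mathcal Z^{\boldsymbol v}_p(s;x)=\frac{1}{\Gamma(s)}\int_0^\infty\frac{e^{-xt}}{e^t-1}\,Li_{\boldsymbol v}\left(\frac{1-e^{-t}}p\right)t^{s-1}\,dt,\qquad Li_{\boldsymbol v}(z)=\sum_{1\le n_1<\cdots<n_k}\frac{z^{n_k}}{n_1^{v_1}\cdots n_k^{v_k}}$$ (with $1/\Gamma(s)=0$ at non-positive integers). The polynomials $B_{p,m}^{\boldsymbol v}(x)$ are defined by the power series expansion at $t=0$ $$\frac{e^{xt}}{e^t-1}\,Li_{\boldsymbol v}\left(\frac{1-e^{-t}}p\right)=\sum_{m=0}^\infty B_{p,m}^{\boldsymbol v}(x)\frac{t^m}{m!}.$$ *)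

(* Defs.v *)
From HB Require Import structures.
From mathcomp Require Import all_boot all_order all_algebra.
From mathcomp Require Import complex.
From mathcomp Require Import all_classical all_reals all_analysis.

Set Implicit Arguments.
Unset Strict Implicit.
Unset Printing Implicit Defensive.

Import Order.TTheory GRing.Theory Num.Theory.
Import numFieldNormedType.Exports.

Local Open Scope classical_set_scope.
Local Open Scope ring_scope.
Local Open Scope complex_scope.

Section Complex.
Context {R : realType}.
Local Notation C := R[i].

(* t ^ s = exp (s ln t), for t > 0 *)
Definition cpow (t : R) (s : C) : C :=
  (t `^ complex.Re s)%:C *
  (cos (complex.Im s * ln t) +i* sin (complex.Im s * ln t)).

Definition cintegrable (D : set R) (f : R -> C) : Prop :=
  (@lebesgue_measure R).-integrable D (EFin \o (fun t => complex.Re (f t))) /\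
  (@lebesgue_measure R).-integrable D (EFin \o (fun t => complex.Im (f t))).

Definition cintegral (D : set R) (f : R -> C) : C :=
  (\int[@lebesgue_measure R]_(t in D) complex.Re (f t)) +i*
  (\int[@lebesgue_measure R]_(t in D) complex.Im (f t)).

(* Differentiability at every point in the complex sense: R[i]^o is
   one-dimensional over the field R[i] itself. *)
Definition entire (F : C -> C) : Prop :=
  forall s : C, derivable (F : C^o -> C^o) s 1.

Definition Euler_integral (s : C) : C :=
  cintegral `]0, +oo[ (fun t => (expR (- t))%:C * cpow t (s - 1)).

(* Euler's integral when 0 < Re s, and Gamma s =
   Gamma (s + n) / (s (s + 1) ... (s + n - 1)), with 0 < Re (s + n), otherwise.
   At the poles 0, -1, -2, ... one factor of the denominator vanishes, so that
   Gamma s = 0 and (Gamma s)^-1 = 0 because 0^-1 = 0. *)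
Definition Gamma_shift (s : C) : nat :=
  if 0 < complex.Re s then 0%N else (Num.truncn (- complex.Re s)).+1.

Definition Gamma (s : C) : C :=
  Euler_integral (s + (Gamma_shift s)%:R) /
  \prod_(i < Gamma_shift s) (s + i%:R).

End Complex.

Section Zeta.
Context {R : realType} (k : nat) (v : k.-tuple nat).

(* [path ltn 0 n] says 0 < n_1 < ... < n_k, and [last 0 n] is n_k (for k > 0).
   The sum over all such tuples is the limit of the sums over n_k <= N, i.e. of
   the partial sums of a power series in z. *)
Definition Li_partial (z : R) (N : nat) : R :=
  \sum_(n : k.-tuple 'I_N.+1 | path ltn 0%N [seq val j | j <- n])
    z ^+ last 0%N [seq val j | j <- n] /
    \prod_(i < k) ((tnth n i)%:R ^+ tnth v i).

Definition Li (z : R) : R := limn (Li_partial z).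

Definition Zintegrand (p x : R) (s : R[i]) (t : R) : R[i] :=
  (expR (- (x * t)) / (expR t - 1) * Li ((1 - expR (- t)) / p))%:C *
  cpow t (s - 1).

Definition Z (p : R) (s : R[i]) (x : R) : R[i] :=
  (Gamma s)^-1 * cintegral `]0, +oo[ (Zintegrand p x s).

Definition Bgen (p x t : R) : R :=
  expR (x * t) / (expR t - 1) * Li ((1 - expR (- t)) / p).

(* b is the coefficient sequence of the expansion of Bgen at t = 0, where it has
   a removable singularity; hence the punctured neighbourhood. *)
Definition is_Bexpansion (p x : R) (b : R^nat) : Prop :=
  \forall t \near 0^',
    [series b m * (t ^+ m / m`!%:R)]_m @ \oo --> Bgen p x t.

(* The value 0 would be returned only if there were no expansion. *)
Definition B (p : R) (m : nat) (x : R) : R :=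
  xget (fun=> 0) [set b : R^nat | is_Bexpansion p x b] m.

End Zeta.

(* Main.v *)
Require Import Defs.
From HB Require Import structures.
From mathcomp Require Import all_boot all_order all_algebra.
From mathcomp Require Import complex.
From mathcomp Require Import all_classical all_reals all_analysis.
From mathcomp Require Import measurable_realfun ring lra.

Set Implicit Arguments.
Unset Strict Implicit.
Unset Printing Implicit Defensive.

Import Order.TTheory GRing.Theory Num.Theory.
Import numFieldNormedType.Exports.

Local Open Scope classical_set_scope.
Local Open Scope ring_scope.
Local Open Scope complex_scope.

(** Write g(t) for the kernel of the integral, so that Z(s) is
    Gamma(s)^-1 times the Mellin transform of g. By construction g(t) is the
    generating function of the polynomials B at -x, so it has a convergent
    expansion at 0, and it decays exponentially at infinity.

    The continuation compares g with combinations of t^m e^{-t}, whose Mellin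
    transforms are Gamma(s + m). If e^t g(t) has the expansion sum_m d_m t^m,
    then r_N(t) = g(t) - e^{-t} sum_(m < N) d_m t^m is O(t^N) at 0 and decays
    exponentially, so its Mellin transform is holomorphic for Re s > -N, and
<<
    F_N(s) = Gamma(s)^-1 Mellin(r_N)(s) + sum_(m < N) d_m s(s+1)...(s+m-1)
>>
    is holomorphic there because 1/Gamma is entire. Passing from N to N + 1
    moves d_N Gamma(s + N) / Gamma(s) = d_N s(s+1)...(s+N-1) from the first
    term to the second, so F_(N+1) = F_N where F_N is defined: the F_N glue to
    one entire function and no identity theorem is required. The kernel is
    O(t^(k-1)) at 0 because n_k >= k in every term of Li; hence d_m = 0 for
    m < k - 1, r_(k-1) = g, and F_(k-1) is the function Z. At s = -m the factor
    1/Gamma vanishes and a finite sum of the d_j is left; multiplying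
    sum_j d_j t^j by e^{-t} identifies it with (-1)^m B_m(-x).

    Four facts carry this. (1) [mellin_derivable]: a Mellin transform is
    complex differentiable, by a second order estimate under the integral sign.
    (2) [Euler_neq0]: Gamma has no zero, by concentration of the Gamma
    distribution. (3) [Bgen_series]: since e^t - 1 = e^t (1 - e^{-t}), the
    generating function with parameter y is e^{(y-1)t} times a power series in
    1 - e^{-t}, which can be rearranged into a power series in t. (4) [Li_partial_le]: for p >= 1,
    Li((1 - e^{-t})/p) <= (t + ln k)^k, so that g decays like e^{-(x+1)t} up to
    a polynomial factor and x + 1 > 0 is enough at infinity. *)

(** * Integration over the half-line *)

Section HalfLine.
Context {R : realType}.
Local Notation mu := (@lebesgue_measure R).
Local Notation Rpos := (`](0 : R), +oo[%classic : set R).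
Implicit Types f g F : R -> R.

(** The index starts at 2 so that the two endpoints are distinct for every n. *)
Definition exhaustion (n : nat) : set R := `[n.+2%:R^-1, n.+2%:R].

Lemma exhaustion_nondecreasing : nondecreasing_seq exhaustion.
Proof.
move=> m n mn; apply/subsetPset => t; rewrite /exhaustion /= !in_itv /=.
case/andP => m1 m2; apply/andP; split.
  by apply: le_trans m1; rewrite lef_pV2 ?posrE ?ltr0n// ler_nat !ltnS.
by apply: (le_trans m2); rewrite ler_nat !ltnS.
Qed.

Lemma near_exhaustion (t : R) : 0 < t -> \forall n \near \oo, exhaustion n t.
Proof.
move=> t0; near=> n; rewrite /exhaustion /= in_itv /=; apply/andP; split.
  rewrite -[leRHS]invrK lef_pV2 ?posrE ?ltr0n ?invr_gt0//.
  apply: (@le_trans _ _ n%:R); last by rewrite ler_nat ltnW.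
  by near: n; exact: nbhs_infty_ger.
apply: (@le_trans _ _ n%:R); last by rewrite ler_nat ltnW.
by near: n; exact: nbhs_infty_ger.
Unshelve. all: by end_near. Qed.

Lemma exhaustion_bigcup : \bigcup_n exhaustion n = Rpos.
Proof.
apply/seteqP; split => t /=.
  move=> [n _]; rewrite /exhaustion /= !in_itv /= andbT => /andP[+ _].
  by apply: lt_le_trans; rewrite invr_gt0.
rewrite in_itv /= andbT => t0.
by have [n _ /(_ n (leqnn _))] := near_exhaustion t0; exists n.
Qed.

Lemma measurable_exhaustion n : measurable (exhaustion n).
Proof. exact: measurable_itv. Qed.

Lemma continuous_halfline_measurable f :
  (forall t : R, 0 < t -> {for t, continuous f}) ->
  measurable_fun Rpos f.
Proof.
move=> fc; apply: open_continuous_measurable_fun => // t.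
by rewrite inE /= in_itv /= andbT; exact: fc.
Qed.

Lemma FTC_exhaustion F f n :
  (forall t : R, 0 < t -> is_derive t (1 : R) F (f t)) ->
  (forall t : R, 0 < t -> {for t, continuous f}) ->
  (\int[mu]_(t in exhaustion n) (f t)%:E =
   (F n.+2%:R - F n.+2%:R^-1)%:E)%E.
Proof.
move=> dF fc.
have n0 : 0 < n.+2%:R^-1 :> R by rewrite invr_gt0.
have n1 : n.+2%:R^-1 < n.+2%:R :> R.
  apply: (@lt_trans _ _ 1); last by rewrite ltr1n.
  by rewrite invf_lt1 ?ltr0n// ltr1n.
have cF t : 0 < t -> {for t, continuous F}.
  move=> t0; apply/differentiable_continuous/derivable1_diffP.
  by have [] := dF _ t0.
rewrite EFinB; apply: continuous_FTC2 => //.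
- apply: continuous_in_subspaceT => t; rewrite inE /= in_itv /= => /andP[t1 _].
  by apply: fc; exact: lt_le_trans t1.
- split.
  + move=> t; rewrite in_itv /= => /andP[t1 _].
    by have [] := dF t (lt_trans n0 t1).
  + exact: cvg_at_right_filter (cF _ n0).
  + exact: cvg_at_left_filter (cF _ (lt_trans n0 n1)).
- move=> t; rewrite in_itv /= => /andP[t1 _].
  by rewrite derive1E; have [_] := dF t (lt_trans n0 t1).
Qed.

(** The integrals over the exhaustion are differences of two values of F, hence
    at most 2K, and monotone convergence applies. *)
Lemma bounded_primitive_integrable F f (K : R) :
  (forall t : R, 0 < t -> is_derive t (1 : R) F (f t)) ->
  (forall t : R, 0 < t -> {for t, continuous f}) ->
  (forall t : R, 0 < t -> 0 <= f t) -> (forall t : R, 0 < t -> `|F t| <= K) ->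
  mu.-integrable Rpos (EFin \o f).
Proof.
move=> dF fc f0 FK; apply/integrableP.
have mf := continuous_halfline_measurable fc.
split; first exact/measurable_EFinP.
have E0 n t : exhaustion n t -> 0 < t.
  by rewrite /exhaustion /= in_itv /= => /andP[+ _]; apply: lt_le_trans; rewrite invr_gt0.
rewrite (_ : (\int[mu]_(x in Rpos) _)%E =
            (\int[mu]_(x in Rpos) (f x)%:E)%E); last first.
  apply: eq_integral => t; rewrite inE /= in_itv /= andbT => t0.
  by rewrite ger0_norm // f0.
apply: (@le_lt_trans _ _ (K + K)%:E); last by rewrite ltry.
rewrite -exhaustion_bigcup.
have := @ge0_nondecreasing_set_cvg_integral _ (measurableTypeR R) _ _ (EFin \o f) mu
  exhaustion_nondecreasing measurable_exhaustion.
have E1 : forall i, measurable_fun (exhaustion i) (EFin \o f).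
  move=> i; apply/measurable_EFinP; apply: measurable_funS mf => //.
  by move=> t /E0; rewrite /= in_itv /= andbT.
have E2 : forall i t, exhaustion i t -> (0 <= (EFin \o f) t)%E.
  by move=> i t /E0 t0; rewrite /= lee_fin f0.
move=> /(_ E1 E2) h.
rewrite -(cvg_lim _ h)//; apply: lime_le; first by apply: cvgP h.
near=> n.
rewrite [leLHS](FTC_exhaustion n dF fc) lee_fin.
apply: (le_trans (ler_norm _)); apply: (le_trans (ler_normB _ _)).
by apply: lerD; apply: FK; rewrite ?invr_gt0.
Unshelve. all: by end_near. Qed.

(** Here f may change sign, so its integrability is a hypothesis and the limit
    along the exhaustion is taken by dominated convergence. *)
Lemma improper_FTC F f (a b : R) :
  (forall t : R, 0 < t -> is_derive t (1 : R) F (f t)) ->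
  (forall t : R, 0 < t -> {for t, continuous f}) ->
  mu.-integrable Rpos (EFin \o f) ->
  F n.+2%:R^-1 @[n --> \oo] --> a -> F n.+2%:R @[n --> \oo] --> b ->
  \int[mu]_(t in Rpos) f t = b - a.
Proof.
move=> dF fc fi Fa Fb.
have E0 n : exhaustion n `<=` Rpos.
  move=> t; rewrite /exhaustion /= !in_itv /= andbT => /andP[+ _].
  by apply: lt_le_trans; rewrite invr_gt0.
have mf : measurable_fun Rpos (EFin \o f) by case/integrableP: fi.
have mfn n : measurable_fun (exhaustion n) (EFin \o f).
  exact: (@measurable_funS _ _ _ _ Rpos _ _ (measurable_itv _) (E0 n) mf).
have mfr n : measurable_fun setT ((EFin \o f) \_ (exhaustion n)).
  by rewrite -(measurable_restrictT (EFin \o f) (measurable_exhaustion n)).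
have [] := @dominated_convergence _ (measurableTypeR R) _ mu Rpos (measurable_itv _)
  (fun n => (EFin \o f) \_ (exhaustion n)) (EFin \o f) (abse \o (EFin \o f)).
- by move=> n; apply: measurable_funTS; exact: mfr.
- exact: mf.
- apply: aeW => t /=; rewrite in_itv /= andbT => t0.
  apply: cvg_near_cst; have := near_exhaustion t0; apply: filterS => n tn.
  by rewrite /restrict mem_set.
- exact: integrable_abse.
- apply: aeW => t n _ /=; rewrite /restrict; case: ifP => // _.
  by rewrite abse0 lee_fin normr_ge0.
move=> _ _ h.
have h' : (F n.+2%:R - F n.+2%:R^-1)%:E @[n --> \oo] -->
    (\int[mu]_(x in Rpos) (EFin \o f) x)%E.
  apply: cvg_trans h; apply: near_eq_cvg; near=> n.
  rewrite -(FTC_exhaustion n dF fc) /=.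
  rewrite -[in RHS](setIidr (E0 n)).
  by rewrite [RHS](integral_mkcondr mu Rpos (exhaustion n) (EFin \o f)).
have h2 : (F n.+2%:R - F n.+2%:R^-1)%:E @[n --> \oo] --> (b - a)%:E.
  by apply: cvg_EFin; [near=> n | exact: cvgB].
by rewrite /Rintegral (cvg_unique _ h' h2).
Unshelve. all: by end_near. Qed.

Let mP : measurable Rpos. Proof. exact: measurable_itv. Qed.

Lemma halfline_integrableZ (c : R) f :
  mu.-integrable Rpos (EFin \o f) ->
  mu.-integrable Rpos (EFin \o (fun t => c * f t)) /\
  \int[mu]_(t in Rpos) (c * f t) = c * \int[mu]_(t in Rpos) f t.
Proof.
move=> fi; split.
  rewrite (_ : _ \o _ = (fun t => c%:E * (EFin \o f) t)%E).
    exact: integrableZl.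
  by apply/funext => t /=; rewrite EFinM.
exact: (@RintegralZl _ (measurableTypeR R) R mu Rpos f c mP fi).
Qed.

Lemma halfline_integrableD f g :
  mu.-integrable Rpos (EFin \o f) -> mu.-integrable Rpos (EFin \o g) ->
  mu.-integrable Rpos (EFin \o (fun t => f t + g t)) /\
  \int[mu]_(t in Rpos) (f t + g t) =
    \int[mu]_(t in Rpos) f t + \int[mu]_(t in Rpos) g t.
Proof.
move=> fi gi; split.
  rewrite (_ : _ \o _ = (EFin \o f) \+ (EFin \o g))%E.
    exact: integrableD.
  by apply/funext => t /=; rewrite EFinD.
exact: (@RintegralD _ (measurableTypeR R) R mu Rpos f g mP fi gi).
Qed.

Lemma halfline_le f g :
  mu.-integrable Rpos (EFin \o f) -> mu.-integrable Rpos (EFin \o g) ->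
  (forall t : R, 0 < t -> f t <= g t) ->
  \int[mu]_(t in Rpos) f t <= \int[mu]_(t in Rpos) g t.
Proof.
move=> fi gi fg; apply: (@le_Rintegral _ (measurableTypeR R) R mu Rpos f g mP fi gi).
by move=> t; rewrite /= in_itv /= andbT; exact: fg.
Qed.

End HalfLine.

(** * The complex exponential *)

Lemma sqr_norm (R : realDomainType) (u : R) : `|u| ^+ 2 = u ^+ 2.
Proof. exact: real_normK (num_real u). Qed.

(** A remainder of second order leaves a difference quotient within M |h| of l.
    With this criterion, differentiating under an integral sign is a matter of
    bounding one integral. *)
Lemma quadratic_derivable_num (K : numFieldType) (F : K^o -> K^o) (s l M e : K) :
  0 < e -> 0 <= M ->
  (forall d : K, `|d| < e -> `|F (s + d) - F s - d * l| <= M * `|d| ^+ 2) ->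
  derivable F s 1.
Proof.
move=> e0 M0 FM; apply/cvg_ex; exists (l : K^o).
apply/cvgrPdist_le => /= eps eps0; near=> h.
have h0 : h != 0 by near: h; exact: nbhs_dnbhs_neq.
have he : `|h| < e by near: h; exact: dnbhs0_lt.
have hM : `|h| < eps / (M + 1).
  by near: h; apply: dnbhs0_lt; rewrite divr_gt0// ltr_wpDl.
have -> : l - h^-1 *: (F (h *: 1 + s) - F s) =
    - (h^-1 * (F (s + h) - F s - h * l)).
  rewrite mulrBr mulrA mulVf// mul1r opprB; congr (_ - _).
  by rewrite [h *: 1]mulr1 [h + s]addrC.
rewrite normrN normrM normfV ler_pdivrMl ?normr_gt0//.
apply: (le_trans (FM _ he)); rewrite expr2 mulrCA ler_wpM2l//.
apply: (@le_trans _ _ ((M + 1) * `|h|)).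
  by rewrite ler_wpM2r// lerDl.
by rewrite mulrC -ler_pdivlMr ?ltr_wpDl// ltW.
Unshelve. all: by end_near. Qed.

Section ComplexBasics.
Context {R : realType}.
Local Notation C := R[i].
Local Notation Re := (@complex.Re R).
Local Notation Im := (@complex.Im R).
Local Notation normc := (@Normc.normc R).
Implicit Types (z w s : C) (a b t : R).

Lemma ReD z w : Re (z + w) = Re z + Re w. Proof. by case: z; case: w. Qed.
Lemma ImD z w : Im (z + w) = Im z + Im w. Proof. by case: z; case: w. Qed.
Lemma ReN z : Re (- z) = - Re z. Proof. by case: z. Qed.
Lemma ImN z : Im (- z) = - Im z. Proof. by case: z. Qed.
Lemma ReM z w : Re (z * w) = Re z * Re w - Im z * Im w.
Proof. by case: z => ? ?; case: w => ? ? /=. Qed.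
Lemma ImM z w : Im (z * w) = Re z * Im w + Im z * Re w.
Proof. by case: z => ? ?; case: w => ? ? /=; rewrite addrC. Qed.
Lemma Re_realM a z : Re (a%:C * z) = a * Re z.
Proof. by case: z => ? ? /=; rewrite mul0r subr0. Qed.
Lemma Im_realM a z : Im (a%:C * z) = a * Im z.
Proof. by case: z => ? ? /=; rewrite mul0r addr0. Qed.
Lemma Re_nat n : Re n%:R = n%:R.
Proof. by elim: n => // n IH; rewrite !mulrSr ReD IH. Qed.
Lemma Im_nat n : Im n%:R = 0.
Proof. by elim: n => // n IH; rewrite !mulrSr ImD IH add0r. Qed.
Lemma normr_complex z : `|z| = (normc z)%:C.
Proof. by case: z. Qed.

Lemma normc_ge0 z : 0 <= normc z.
Proof. by case: z => a b; exact: sqrtr_ge0. Qed.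

Lemma le_Re_normc z : `|Re z| <= normc z.
Proof.
by case: z => a b /=; rewrite -sqrtr_sqr ler_sqrt ?addr_ge0 ?sqr_ge0// lerDl sqr_ge0.
Qed.

Lemma le_Im_normc z : `|Im z| <= normc z.
Proof.
by case: z => a b /=; rewrite -sqrtr_sqr ler_sqrt ?addr_ge0 ?sqr_ge0// lerDr sqr_ge0.
Qed.

Lemma normc_le_ReIm z : normc z <= `|Re z| + `|Im z|.
Proof.
case: z => a b /=; rewrite -[leRHS]ger0_norm ?addr_ge0// -sqrtr_sqr.
rewrite ler_sqrt ?sqr_ge0// sqrrD -[a ^+ 2]sqr_norm -[b ^+ 2]sqr_norm.
rewrite -addrA lerD2l lerDr.
by rewrite mulrn_wge0// mulr_ge0.
Qed.

Lemma normc_real a : normc a%:C = `|a|.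
Proof. by rewrite /= expr0n /= addr0 sqrtr_sqr. Qed.

Lemma quadratic_derivable (F : C -> C) s l (K e : R) : 0 < e ->
  (forall d, normc d <= e ->
     normc (F (s + d) - F s - d * l) <= K * normc d ^+ 2) ->
  derivable (F : C^o -> C^o) s 1.
Proof.
move=> e0 FK.
have K0 : 0 <= K.
  have := FK e%:C; rewrite normc_real gtr0_norm// lexx => /(_ isT) h.
  have := le_trans (normc_ge0 _) h.
  by rewrite pmulr_lge0// exprn_gt0.
apply: (@quadratic_derivable_num C F s l K%:C e%:C); rewrite ?ltcR ?lecR//.
move=> d; rewrite !normr_complex ltcR => /ltW/FK.
by rewrite -rmorphXn -rmorphM lecR.
Qed.

Definition cexp w : C := (expR (Re w))%:C * (cos (Im w) +i* sin (Im w)).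

Lemma cexpD w z : cexp (w + z) = cexp w * cexp z.
Proof.
rewrite /cexp ReD ImD expRD rmorphM /= cosD sinD.
set A := expR _; set B := expR _; apply/eqP; rewrite eq_complex /=.
by apply/andP; split; apply/eqP; ring.
Qed.

Lemma cexp0 : cexp 0 = 1.
Proof. by rewrite /cexp /= expR0 cos0 sin0 mul1r. Qed.

Lemma normc_cexp w : normc (cexp w) = expR (Re w).
Proof.
rewrite /cexp Normc.normcM normc_real ger0_norm ?expR_ge0//.
by rewrite /= cos2Dsin2 sqrtr1 mulr1.
Qed.

Lemma cpowE t s : 0 < t -> cpow t s = cexp ((ln t)%:C * s).
Proof.
move=> t0; rewrite /cpow /cexp ReM ImM /= !mul0r subr0 addr0.
by rewrite /powR gt_eqF// [ln t * Re s]mulrC [ln t * Im s]mulrC.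
Qed.

Lemma cpowD t s z : 0 < t -> cpow t (s + z) = cpow t s * cpow t z.
Proof. by move=> t0; rewrite !cpowE// mulrDr cexpD. Qed.

Lemma normc_cpow t s : 0 < t -> normc (cpow t s) = expR (Re s * ln t).
Proof.
by move=> t0; rewrite cpowE// normc_cexp ReM /= mul0r subr0 mulrC.
Qed.

Lemma cpow1 t : 0 < t -> cpow t 1 = t%:C.
Proof.
by move=> t0; rewrite cpowE// mulr1 /cexp /= lnK ?posrE// cos0 sin0 -[RHS]mulr1.
Qed.

Lemma cpow_nat t n : 0 < t -> cpow t n%:R = (t ^+ n)%:C.
Proof.
move=> t0; elim: n => [|n IH].
  by rewrite cpowE// mulr0 cexp0.
by rewrite mulrSr cpowD// IH cpow1// exprSr rmorphM.
Qed.

End ComplexBasics.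

Section Trig.
Context {R : realType}.
Implicit Types a b u t : R.

Lemma sqr_le_expR u : u ^+ 2 <= 2 * expR `|u|.
Proof.
have := @expR_ge1Dxn R `|u| 1 (normr_ge0 u).
by rewrite sqr_norm (_ : (2`!)%:R = 2) // => h; lra.
Qed.

Lemma norm_le_expR u : `|u| <= expR `|u|.
Proof. by apply: le_trans (expR_ge1Dx _); rewrite lerDr. Qed.

Lemma nonneg_of_derive (f df : R -> R) :
  (forall t : R, is_derive t (1 : R) f (df t)) -> f 0 = 0 ->
  (forall t, 0 <= t -> 0 <= df t) -> forall u, 0 <= u -> 0 <= f u.
Proof.
move=> fdf f0 df0 u u0.
have [|c /[!in_itv]/= /andP[c0 _]] := @MVT_segment _ f df 0 u u0 (fun x _ => fdf x).
  apply: continuous_subspaceT => x.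
  by apply/differentiable_continuous/derivable1_diffP; have [] := fdf x.
by rewrite f0 !subr0 => ->; rewrite mulr_ge0// df0.
Qed.

Lemma sin_le_id u : 0 <= u -> sin u <= u.
Proof.
move=> u0; rewrite -subr_ge0.
have D t : is_derive t (1 : R) (id - sin)%R (1 - cos t) by apply: is_deriveB.
apply: (nonneg_of_derive D _ _ u0).
  by change (0 - sin 0 = 0 :> R); rewrite sin0 subr0.
by move=> t _; rewrite subr_ge0 cos_le1.
Qed.

Let is_derive_sqr t : is_derive t (1 : R) (fun r => r ^+ 2) (2 * t).
Proof.
have D := @is_deriveM R R^o id id t 1 1 1 (is_derive_id t 1) (is_derive_id t 1).
rewrite (_ : 2 * t = t *: 1 + t *: 1); last by rewrite [t *: 1]mulr1 mulr_natl.
by rewrite (_ : (fun r => _) = (id * id)%R).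
Qed.

Lemma oneBcos_le u : 1 - cos u <= u ^+ 2.
Proof.
wlog u0 : u / 0 <= u.
  move=> H; case: (leP 0 u) => [/H//|/ltW u0].
  by have := H (- u); rewrite cosN sqrrN oppr_ge0; apply.
rewrite -subr_ge0 opprB addrA addrAC.
have D t : is_derive t (1 : R) ((fun r => r ^+ 2) - cst 1 + cos)%R
    (2 * t - 0 + - sin t).
  by apply: is_deriveD; apply: is_deriveB.
apply: (nonneg_of_derive D _ _ u0).
  by change (0 ^+ 2 - 1 + cos 0 = 0 :> R); rewrite expr0n cos0 add0r addNr.
by move=> t t0; have := sin_le_id t0; lra.
Qed.

Lemma norm_sinB_le u : `|sin u - u| <= u ^+ 2.
Proof.
wlog u0 : u / 0 <= u.
  move=> H; case: (leP 0 u) => [/H//|/ltW u0].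
  by have := H (- u); rewrite sinN sqrrN oppr_ge0 -opprD normrN; apply.
rewrite ler_distl; have := sin_le_id u0.
have : 0 <= u ^+ 2 - u + sin u.
  have D t : is_derive t (1 : R) ((fun r => r ^+ 2) - id + sin)%R
      (2 * t - 1 + cos t).
    by apply: is_deriveD; apply: is_deriveB.
  apply: (nonneg_of_derive D _ _ u0).
    by change (0 ^+ 2 - 0 + sin 0 = 0 :> R); rewrite expr0n sin0 subr0 addr0.
  move=> t t0.
  have D' r : is_derive r (1 : R) ((fun q => 2 *: q) - cst 1 + cos)%R
      (2 *: 1 - 0 + - sin r).
    by apply: is_deriveD; apply: is_deriveB; apply: is_deriveZ.
  apply: (nonneg_of_derive D' _ _ t0).
    by change (2 * 0 - 1 + cos 0 = 0 :> R); rewrite mulr0 cos0 add0r addNr.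
  move=> r _; rewrite [2 *: 1]mulr1.
  by have := sin_le1 r; lra.
by have := sqr_ge0 u; move=> *; apply/andP; split; lra.
Qed.

Lemma le1_expR a : (1 <= expR a) = (0 <= a).
Proof. by rewrite -{1}expR0 ler_expR. Qed.

Lemma expR_bounds a : [/\ `|expR a - 1| <= `|a| * expR `|a|,
   `|expR a - 1 - a| <= a ^+ 2 * expR `|a| & expR a <= expR `|a|].
Proof.
split; last by rewrite ler_expR ler_norm.
- have [a0|a0] := leP 0 a.
    rewrite !ger0_norm// ?subr_ge0 ?le1_expR//.
    have h1 := expR_ge1Dx (- a); have h2 := expRxMexpNx_1 a.
    by have h3 := expR_gt0 a; nra.
  have h := expR_ge1Dx a; have h1 : expR a < 1 by rewrite expR_lt1.
  rewrite ltr0_norm ?subr_lt0// (ltr0_norm a0) opprB.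
  apply: (@le_trans _ _ (- a)); first lra.
  by rewrite ler_peMr ?oppr_ge0 ?(ltW a0)// le1_expR oppr_ge0 ltW.
- have h := expR_ge1Dx a; rewrite ger0_norm; last lra.
  have [a0|a0] := leP 0 a.
    rewrite ger0_norm//.
    have h1 := expR_ge1Dx (- a); have h2 := expRxMexpNx_1 a; have h3 := expR_gt0 a.
    have h4 : expR a - 1 <= a * expR a by nra.
    have h5 : expR a - 1 - a <= a * (expR a - 1) by lra.
    by apply: (le_trans h5); rewrite expr2 -mulrA ler_wpM2l.
  rewrite ltr0_norm//.
  have h1 : 1 <= expR (- a) by rewrite le1_expR oppr_ge0 ltW.
  have h2 := expRxMexpNx_1 a; have h3 := expR_gt0 a.
  have h4 := expR_ge1Dx (- a).
  have h5 : expR a * (1 - a) <= 1 by nra.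
  apply: (@le_trans _ _ (a ^+ 2)); first nra.
  by rewrite ler_peMr// sqr_ge0.
Qed.

Local Notation normc := (@Normc.normc R).

(** Only the real part of w enters the exponential factor; this matters below,
    where the factor becomes a power of t. The constant is crude: the real and
    the imaginary part contribute 2 each. *)
Lemma cexp_taylor1 (w : R[i]) :
  normc (cexp w - 1 - w) <= 4 * normc w ^+ 2 * expR `|complex.Re w|.
Proof.
apply: le_trans (normc_le_ReIm _) _.
have := le_Re_normc w; have := le_Im_normc w; have := normc_ge0 w.
move: (normc w) => n n0; case: w => a b /= hb ha.
rewrite (_ : _ - 1 - a = expR a * cos b - 1 - a); last by ring.
rewrite (_ : _ - 0 - b = expR a * sin b - b); last by ring.
have [h1 h2 h3] := expR_bounds a.
have E0 := expR_ge0 `|a|; have e0 := expR_ge0 a.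
have c1 : `|cos b - 1| <= b ^+ 2.
  by rewrite distrC ger0_norm ?subr_ge0 ?cos_le1// oneBcos_le.
have s1 := norm_sinB_le b.
have a2 : a ^+ 2 <= n ^+ 2 by rewrite -sqr_norm lerXn2r ?nnegrE.
have b2 : b ^+ 2 <= n ^+ 2 by rewrite -[b ^+ 2]sqr_norm lerXn2r ?nnegrE.
have p1 : `|expR a * cos b - 1 - a| <= n ^+ 2 * expR `|a| + n ^+ 2 * expR `|a|.
  rewrite (_ : _ - a = (expR a - 1 - a) + expR a * (cos b - 1)); last by ring.
  apply: le_trans (ler_normD _ _) _; apply: lerD.
    by apply: (le_trans h2); rewrite ler_wpM2r.
  rewrite normrM ger0_norm// mulrC.
  by apply: ler_pM => //; apply: le_trans c1 _.
have p2 : `|expR a * sin b - b| <= n ^+ 2 * expR `|a| + n ^+ 2 * expR `|a|.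
  rewrite (_ : _ - b = expR a * (sin b - b) + b * (expR a - 1)); last by ring.
  apply: le_trans (ler_normD _ _) _; apply: lerD.
    rewrite normrM ger0_norm// mulrC.
    by apply: ler_pM => //; apply: le_trans s1 _.
  rewrite normrM; apply: (@le_trans _ _ (n * (n * expR `|a|))); last first.
    by rewrite mulrA -expr2.
  apply: ler_pM => //; apply: (le_trans h1); rewrite ler_wpM2r//.
by lra.
Qed.

End Trig.

(** * Complex integrals over the half-line *)

Section Mellin.
Context {R : realType}.
Local Notation C := R[i].
Local Notation mu := (@lebesgue_measure R).
Local Notation Rpos := (`](0 : R), +oo[%classic : set R).
Local Notation Re := (@complex.Re R).
Local Notation Im := (@complex.Im R).
Local Notation normc := (@Normc.normc R).
Implicit Types (f g h : R -> R) (s z : C) (a b t : R).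

(** t^a e^{-bt} for t > 0, written as a single exponential so that exponents add
    up. *)
Definition weight a b t : R := expR (a * ln t - b * t).

(** Powers of t are dominated by e^{bt}: take ln u < u at u = bt / a. *)
Lemma expR_ln_le a b : 0 < a -> 0 < b ->
  exists2 K, 0 < K & forall t, 0 < t -> expR (a * ln t) <= K * expR (b * t).
Proof.
move=> a0 b0; exists (expR (- (a * ln (b / a)))); first exact: expR_gt0.
move=> t t0; rewrite -expRD ler_expR.
have ba : 0 < b / a by rewrite divr_gt0.
have := ln_sublinear (mulr_gt0 ba t0).
rewrite [ln (b / a * t)]lnM ?posrE// -(ltr_pM2l a0) => /ltW.
rewrite [a * (b / a * t)]mulrA [a * (b / a)]mulrCA divff ?gt_eqF// mulr1 mulrDr.
by move=> h; lra.
Qed.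

Lemma is_derive_expR_ln c t : 0 < t ->
  is_derive t (1 : R) (fun r => expR (c * ln r)) (expR (c * ln t) * (c * t^-1)).
Proof.
move=> t0; apply: (@is_derive1_comp _ expR (fun r => c * ln r)).
exact: is_deriveZ (is_derive1_ln t0).
Qed.

(** With c = a + 1, compare t^a e^{-bt} with a multiple of t^(c-1) / (1 + t^c)^2,
    the derivative of the bounded function -1 / (c (1 + t^c)). Both ends of the
    half-line are dealt with at once. *)
Lemma weight_integrable a b : -1 < a -> 0 < b ->
  mu.-integrable Rpos (EFin \o weight a b).
Proof.
move=> a1 b0; pose c := a + 1; have c0 : 0 < c by rewrite /c; lra.
(* K bounds t^(2c) e^{-bt}, and (1 + t^c)^2 <= 2 + 2 t^(2c), whence M. *)
have [K K0 KE] := @expR_ln_le (2 * c) b ltac:(lra) b0.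
pose E t := expR (c * ln t); pose M := 2 + 2 * K.
pose F t := - (M / c) * (1 + E t)^-1.
pose f t := M * (E t / t / (1 + E t) ^+ 2).
have E0 t : 0 < E t by exact: expR_gt0.
have E1 t : 1 + E t != 0 by rewrite gt_eqF// ltr_wpDl.
have M0 : 0 < M by rewrite /M; lra.
have dE t : 0 < t -> is_derive t (1 : R) E (E t * (c * t^-1)).
  exact: is_derive_expR_ln.
have d1E t : 0 < t -> is_derive t (1 : R) (fun r => 1 + E r) (E t * (c * t^-1)).
  move=> t0; have := dE _ t0 => {}dE.
  have : is_derive t (1 : R) (cst 1 + E)%R (0 + E t * (c * t^-1)).
    by apply: is_deriveD.
  by rewrite add0r.
have dF t : 0 < t -> is_derive t (1 : R) F (f t).
  move=> t0; have D := @is_deriveV R (fun r => 1 + E r) t _ 1 (E1 t) (d1E t t0).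
  have D' : is_derive t (1 : R) (- (M / c) \*: (fun r => (1 + E r)^-1))
      (- (M / c) *: (- (1 + E t) ^- 2 *: (E t * (c * t^-1)))) by exact: is_deriveZ.
  apply: (is_derive_eq D'); rewrite /f.
  rewrite /GRing.scale /=; field.
  by rewrite E1 !gt_eqF.
have fc t : 0 < t -> {for t, continuous f}.
  move=> t0.
  have cE : {for t, continuous E}.
    apply/differentiable_continuous/derivable1_diffP.
    by have [] := dE _ t0.
  have c1E : {for t, continuous (fun r => (1 + E r) ^+ 2)}.
    have c1 : {for t, continuous (fun r => 1 + E r)}.
      by apply: continuousD => //; exact: cst_continuous.
    exact: (@continuous_comp _ _ _ (fun r => 1 + E r) (fun y => y ^+ 2) t c1
      (@exprn_continuous R 2 _)).
  apply: continuousM; first exact: cst_continuous.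
  apply: continuousM; first apply: continuousM => //.
    by apply: continuousV => //; rewrite gt_eqF.
  by apply: continuousV => //; rewrite expf_neq0.
have f0 t : 0 < t -> 0 <= f t.
  by move=> t0; rewrite mulr_ge0 ?divr_ge0 ?sqr_ge0 ?(ltW M0) ?(ltW (E0 t)) ?(ltW t0).
have FK t : 0 < t -> `|F t| <= M / c.
  move=> t0; rewrite /F mulNr normrN ger0_norm; last first.
    by rewrite !divr_ge0// ltW// addr_gt0.
  rewrite ler_piMr//; first by rewrite divr_ge0// ltW.
  by rewrite invf_le1 ?addr_gt0// lerDl ltW.
have fi := bounded_primitive_integrable dF fc f0 FK.
apply: le_integrable fi => //.
  apply/measurable_EFinP; apply: continuous_halfline_measurable => t t0.
  apply: continuous_comp; last exact: continuous_expR.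
  by apply: continuousB; apply: continuousM => //;
    [exact: cst_continuous|exact: continuous_ln|exact: cst_continuous].
move=> t /=; rewrite in_itv /= andbT => t0.
rewrite lee_fin !ger0_norm ?f0 ?expR_ge0// /f.
have -> : weight a b t = E t / t * expR (- (b * t)).
  rewrite /weight /E /c mulrDl mul1r !expRD lnK ?posrE//.
  by rewrite mulfK ?gt_eqF.
rewrite mulrCA ler_wpM2l//; first by rewrite divr_ge0// ltW.
rewrite ler_pdivlMr ?exprn_gt0 ?addr_gt0// expRN mulrC ler_pdivrMr ?expR_gt0//.
have h := KE _ t0; have e1 : 1 <= expR (b * t) by rewrite le1_expR mulr_ge0 ?ltW.
have EE : E t ^+ 2 = expR (2 * c * ln t).
  by rewrite /E -expRM_natl mulrA.
rewrite -EE in h; have := sqr_ge0 (E t - 1); rewrite /M; nra.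
Qed.

Lemma measurable_cpow s :
  measurable_fun setT (fun t => Re (cpow t s)) /\
  measurable_fun setT (fun t => Im (cpow t s)).
Proof.
have ml : measurable_fun setT (fun t => Im s * ln t).
  by apply: measurable_funM => //; exact: measurable_ln.
have mp : measurable_fun setT (fun t => t `^ Re s).
  exact: measurable_powR.
split.
- rewrite (_ : (fun t => _) = (fun t => t `^ Re s * cos (Im s * ln t))).
    apply: measurable_funM => //; apply: measurableT_comp ml.
    by apply: continuous_measurable_fun; exact: continuous_cos.
  by apply/funext => t; rewrite /cpow ReM /= mul0r subr0.
- rewrite (_ : (fun t => _) = (fun t => t `^ Re s * sin (Im s * ln t))).
    apply: measurable_funM => //; apply: measurableT_comp ml.
    by apply: continuous_measurable_fun; exact: continuous_sin.
  by apply/funext => t; rewrite /cpow ImM /= mul0r addr0.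
Qed.

Implicit Types F G : R -> C.

Lemma integrable_le f g : measurable_fun Rpos f ->
  mu.-integrable Rpos (EFin \o g) -> (forall t, 0 < t -> `|f t| <= g t) ->
  mu.-integrable Rpos (EFin \o f) /\
  `|\int[mu]_(t in Rpos) f t| <= \int[mu]_(t in Rpos) g t.
Proof.
move=> mf gi fg.
have fg' t : Rpos t -> `|f t| <= g t.
  by rewrite /= in_itv /= andbT; exact: fg.
have mP : measurable Rpos by exact: measurable_itv.
have fi : mu.-integrable Rpos (EFin \o f).
  apply: (@le_integrable _ (measurableTypeR R) R mu Rpos mP (EFin \o f) (EFin \o g)) => //.
    exact/measurable_EFinP.
  by move=> t /fg' h /=; rewrite lee_fin (le_trans h)// ler_norm.
split; first exact: fi.
apply: (le_trans (@le_normr_Rintegral _ (measurableTypeR R) R mu Rpos f mP fi)).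
have nfi : mu.-integrable Rpos (EFin \o (fun t => `|f t|)).
  exact: integrable_norm fi.
by apply: (@le_Rintegral _ (measurableTypeR R) R mu Rpos _ g mP nfi gi).
Qed.

(** The factor 2 comes from bounding the real and the imaginary part separately. *)
Lemma cintegrable_le F g :
  measurable_fun Rpos (fun t => Re (F t)) ->
  measurable_fun Rpos (fun t => Im (F t)) ->
  mu.-integrable Rpos (EFin \o g) -> (forall t, 0 < t -> normc (F t) <= g t) ->
  cintegrable Rpos F /\
  normc (cintegral Rpos F) <= 2 * \int[mu]_(t in Rpos) g t.
Proof.
move=> mR mI gi Fg.
have [i1 n1] := integrable_le mR gi
  (fun t (ht : 0 < t) => le_trans (le_Re_normc (F t)) (Fg t ht)).
have [i2 n2] := integrable_le mI gi
  (fun t (ht : 0 < t) => le_trans (le_Im_normc (F t)) (Fg t ht)).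
split; first by split.
apply: le_trans (normc_le_ReIm _) _ => /=.
by rewrite mulr_natl mulr2n lerD.
Qed.

Lemma eq_cintegral F G : (forall t, 0 < t -> F t = G t) ->
  cintegral Rpos F = cintegral Rpos G.
Proof.
move=> FG; rewrite /cintegral.
by congr (_ +i* _); apply: eq_Rintegral => t; rewrite inE /= in_itv /= andbT => /FG ->.
Qed.

Lemma eq_cintegrable F G : (forall t, 0 < t -> F t = G t) ->
  cintegrable Rpos F -> cintegrable Rpos G.
Proof.
move=> FG [h1 h2]; split; [apply: eq_integrable h1 | apply: eq_integrable h2] => //.
all: by move=> t; rewrite inE /= in_itv /= andbT => /FG ->.
Qed.

Lemma cintegrableD F G : cintegrable Rpos F -> cintegrable Rpos G ->
  cintegrable Rpos (fun t => F t + G t) /\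
  cintegral Rpos (fun t => F t + G t) = cintegral Rpos F + cintegral Rpos G.
Proof.
move=> [F1 F2] [G1 G2].
have [iR eR] := halfline_integrableD F1 G1.
have [iI eI] := halfline_integrableD F2 G2.
split; last first.
  rewrite /cintegral; apply/eqP; rewrite eq_complex /= -eR -eI.
  by apply/andP; split; apply/eqP; apply: eq_Rintegral => t _; rewrite ?ReD ?ImD.
split; [move: iR | move: iI]; apply: eq_integrable => // t _ /=.
  by rewrite ReD.
by rewrite ImD.
Qed.

Lemma cintegrableZ z F : cintegrable Rpos F ->
  cintegrable Rpos (fun t => z * F t) /\
  cintegral Rpos (fun t => z * F t) = z * cintegral Rpos F.
Proof.
move=> [F1 F2].
have [i1 e1] := halfline_integrableZ (Re z) F1.
have [i2 e2] := halfline_integrableZ (- Im z) F2.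
have [i3 e3] := halfline_integrableZ (Re z) F2.
have [i4 e4] := halfline_integrableZ (Im z) F1.
have [iR eR] := halfline_integrableD i1 i2.
have [iI eI] := halfline_integrableD i3 i4.
split; last first.
  rewrite /cintegral; apply/eqP; rewrite eq_complex ReM ImM /=.
  rewrite -mulNr -e1 -e2 -e3 -e4 -eR -eI.
  by apply/andP; split; apply/eqP; apply: eq_Rintegral => t _;
    rewrite ?ReM ?ImM ?mulNr.
split; [move: iR | move: iI]; apply: eq_integrable => // t _ /=.
  by rewrite ReM mulNr.
by rewrite ImM.
Qed.

End Mellin.

(** * Holomorphy of Mellin transforms *)

Section MellinTransform.
Context {R : realType}.
Local Notation C := R[i].
Local Notation mu := (@lebesgue_measure R).
Local Notation Rpos := (`](0 : R), +oo[%classic : set R).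
Local Notation Re := (@complex.Re R).
Local Notation Im := (@complex.Im R).
Local Notation normc := (@Normc.normc R).
Implicit Types (f g h : R -> R) (s z d : C).

Definition mellin_integrand h s (t : R) : C := (h t)%:C * cpow t (s - 1).
Definition mellin h s : C := cintegral Rpos (mellin_integrand h s).

(** Vanishing to order N at 0 and exponential decay at infinity, in a single
    bound: the Mellin transform of such a function converges for Re s > -N. *)
Definition of_order (N : nat) h :=
  measurable_fun Rpos h /\ exists K b : R, 0 < b /\
    forall t, 0 < t -> `|h t| <= K * weight N%:R b t.

Lemma weightM (a b c t : R) :
  weight a b t * expR (c * ln t) = weight (a + c) b t.
Proof. by rewrite /weight -expRD; congr expR; ring. Qed.

Lemma measurable_realM_cpow f s : measurable_fun Rpos f ->
  measurable_fun Rpos (fun t => Re ((f t)%:C * cpow t s)) /\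
  measurable_fun Rpos (fun t => Im ((f t)%:C * cpow t s)).
Proof.
move=> mf; have [m1 m2] := measurable_cpow s.
split.
- rewrite (_ : (fun t => _) = (fun t => f t * Re (cpow t s))).
    by apply: measurable_funM => //; exact: measurable_funTS.
  by apply/funext => t; rewrite Re_realM.
- rewrite (_ : (fun t => _) = (fun t => f t * Im (cpow t s))).
    by apply: measurable_funM => //; exact: measurable_funTS.
  by apply/funext => t; rewrite Im_realM.
Qed.

Lemma integrableZ_weight2 (M a1 a2 b : R) : -1 < a1 -> -1 < a2 -> 0 < b ->
  mu.-integrable Rpos (EFin \o (fun t => M * (weight a1 b t + weight a2 b t))).
Proof.
move=> h1 h2 b0; apply: (halfline_integrableZ M _).1.
by apply: (halfline_integrableD _ _).1; exact: weight_integrable.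
Qed.

Section OfOrder.
Variables (N : nat) (h : R -> R) (s : C).
Hypotheses (hN : of_order N h) (sN : - N%:R < Re s).

Let sN0 : 0 < N%:R + Re s.
Proof. by rewrite addrC -ltrBlDr sub0r. Qed.

Lemma normc_mellin_integrand (K b t : R) : 0 < t ->
  `|h t| <= K * weight N%:R b t ->
  normc (mellin_integrand h s t) <= K * weight (N%:R + Re s - 1) b t.
Proof.
move=> t0 hK; rewrite /mellin_integrand Normc.normcM normc_real normc_cpow//.
rewrite ReD ReN /= -addrA -weightM mulrA.
by rewrite ler_wpM2r// expR_ge0.
Qed.

Lemma mellin_cintegrable : cintegrable Rpos (mellin_integrand h s).
Proof.
have [mh [K [b [b0 hK]]]] := hN.
have [m1 m2] := measurable_realM_cpow (s - 1) mh.
have wi : mu.-integrable Rpos (EFin \o weight (N%:R + Re s - 1) b).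
  by have h0 := sN0; apply: weight_integrable => //; lra.
have [gi _] := halfline_integrableZ K wi.
have [] // := @cintegrable_le _ (mellin_integrand h s) _ m1 m2 gi.
by move=> t t0; apply: normc_mellin_integrand; rewrite ?hK.
Qed.

End OfOrder.

(** The increment t^d - 1 - d ln t is O(|d|^2 (ln t)^2 t^(+-|d|)), and
    (ln t)^2 costs only an arbitrarily small power of t at either end, so the
    second order remainder stays integrable for Re s > -N. *)
Lemma mellin_derivable N h s : of_order N h -> - N%:R < Re s ->
  derivable (mellin h : C^o -> C^o) s 1.
Proof.
move=> hN sN; have sN1 : 0 < N%:R + Re s by lra.
have [mh [K [b [b0 hK]]]] := hN.
(* The exponent a moves by at most 2e, which keeps it above -1: one e absorbs
   (ln t)^2 and the other one t^d. *)
pose a := N%:R + Re s - 1; pose e := (N%:R + Re s) / 4.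
have e0 : 0 < e by rewrite divr_gt0.
have a1 : -1 < a + 2 * e by rewrite /a /e; lra.
have a2 : -1 < a + - (2 * e) by rewrite /a /e; lra.
pose W t := weight (a + 2 * e) b t + weight (a + - (2 * e)) b t.
have W_expR t : 0 < t -> weight a b t * expR (2 * (e * `|ln t|)) <= W t.
  move=> t0; rewrite /W -(weightM a b (2 * e)) -(weightM a b (- (2 * e))) -mulrDr.
  rewrite ler_wpM2l ?expR_ge0//.
  have [l0|l0] := ger0P (ln t).
    by rewrite mulrA lerDl expR_ge0.
  by rewrite !mulrN mulrA mulNr lerDr expR_ge0.
pose D t := (h t * ln t)%:C * cpow t (s - 1).
have mD : measurable_fun Rpos (fun t => h t * ln t).
  by apply: measurable_funM => //; apply: measurable_funTS; exact: measurable_ln.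
have ED t : D t = (ln t)%:C * mellin_integrand h s t.
  by rewrite /D rmorphM /= /mellin_integrand mulrA [(h t)%:C * _]mulrC.
have K0 : 0 <= K.
  have := le_trans (normr_ge0 _) (hK 1 ltr01).
  by rewrite pmulr_lge0// expR_gt0.
have bound t (c Q : R) : 0 < t -> 0 <= Q -> 0 <= c ->
    c <= Q * expR (2 * (e * `|ln t|)) ->
    normc (mellin_integrand h s t) * c <= (K * Q) * W t.
  move=> t0 Q0 c0 cQ.
  have hn := normc_mellin_integrand s t0 (hK t t0).
  apply: le_trans (ler_pM (normc_ge0 _) c0 hn cQ) _.
  rewrite mulrACA ler_wpM2l ?mulr_ge0//.
  exact: W_expR.
have expR2 (u : R) : expR u ^+ 2 = expR (2 * u) by rewrite expRM_natl.
have normD t : 0 < t -> normc (D t) <= (K * e^-1) * W t.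
  move=> t0; rewrite ED Normc.normcM normc_real mulrC.
  apply: bound; rewrite ?invr_ge0 ?(ltW e0)//.
  rewrite -ler_pdivrMl ?invr_gt0// invrK.
  have := norm_le_expR (e * ln t); rewrite normrM (gtr0_norm e0) => /le_trans; apply.
  by rewrite ler_expR ler_peMl ?ler1n// mulr_ge0// ltW.
pose Rem d t := mellin_integrand h s t * (cexp ((ln t)%:C * d) - 1 - (ln t)%:C * d).
have ERem d t : 0 < t ->
    Rem d t = mellin_integrand h (s + d) t + (-1) * mellin_integrand h s t + (- d) * D t.
  move=> t0; rewrite ED /Rem /mellin_integrand (addrAC s d) (cpowD (s - 1) d t0) (cpowE d t0).
  by ring.
have normRem d t : 0 < t -> normc d <= e ->
    normc (Rem d t) <= (K * (8 / e ^+ 2)) * W t * normc d ^+ 2.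
  move=> t0 de; rewrite /Rem Normc.normcM.
  have [->|d0] := eqVneq d 0.
    rewrite mulr0 cexp0 subrr subr0 Normc.normc0 mulr0 expr0n /= mulr0//.
  have dn0 : 0 < normc d.
    rewrite lt_neqAle normc_ge0 andbT eq_sym.
    by apply: contraNneq d0 => /Normc.eq0_normc ->.
  rewrite -ler_pdivrMr ?exprn_gt0// -[leLHS]mulrA.
  apply: bound => //.
  - by rewrite divr_ge0// sqr_ge0.
  - by rewrite divr_ge0 ?normc_ge0// sqr_ge0.
  rewrite ler_pdivrMr ?exprn_gt0//; apply: le_trans (cexp_taylor1 _) _.
  rewrite Normc.normcM normc_real exprMn sqr_norm.
  have l2 := sqr_le_expR (e * ln t).
  rewrite normrM (gtr0_norm e0) exprMn in l2.
  have l3 : expR `|Re ((ln t)%:C * d)| <= expR (e * `|ln t|).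
    rewrite ler_expR Re_realM normrM mulrC ler_wpM2r//.
    by apply: le_trans (le_Re_normc _) de.
  have l4 : ln t ^+ 2 <= 2 / e ^+ 2 * expR (e * `|ln t|).
    by rewrite -mulrA mulrCA ler_pdivlMl ?exprn_gt0//.
  rewrite -expR2 expr2.
  have := ler_pM (sqr_ge0 _) (expR_ge0 _) l4 l3.
  set X := expR (e * _); set Y := expR `|_|; set n := normc d.
  move=> h1; have n0 : 0 <= 4 * n ^+ 2 by rewrite mulr_ge0// sqr_ge0.
  have := ler_wpM2l n0 h1.
  rewrite (_ : 4 * n ^+ 2 * (ln t ^+ 2 * Y) = 4 * (ln t ^+ 2 * n ^+ 2) * Y); last ring.
  move/le_trans; apply; rewrite le_eqVlt; apply/orP; left; apply/eqP.
  by rewrite [RHS]mulrC; ring.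
have mD2 := measurable_realM_cpow (s - 1) mD.
have gi M := integrableZ_weight2 M a1 a2 b0.
have [Di _] := cintegrable_le mD2.1 mD2.2 (gi _) normD.
have h0i := mellin_cintegrable hN sN.
apply: (@quadratic_derivable _ _ _ (cintegral Rpos D)
  (2 * \int[mu]_(t in Rpos) ((K * (8 / e ^+ 2)) * W t)) e e0) => d de.
have sdN : - N%:R < Re (s + d).
  have := le_trans (le_Re_normc d) de; rewrite ler_norml => /andP[+ _].
  by rewrite ReD /e; lra.
have h1i := mellin_cintegrable hN sdN.
have [h2i h2E] := cintegrableZ (-1) h0i.
have [h3i h3E] := cintegrableD h1i h2i.
have [h4i h4E] := cintegrableZ (- d) Di.
have [h5i h5E] := cintegrableD h3i h4i.
rewrite (_ : mellin h (s + d) - mellin h s - d * _ = cintegral Rpos (fun t =>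
    mellin_integrand h (s + d) t + -1 * mellin_integrand h s t + - d * D t)); last first.
  by rewrite h5E h3E h2E h4E mulN1r mulNr.
have [gdi gdE] := halfline_integrableZ (normc d ^+ 2) (gi (K * (8 / e ^+ 2))).
have [mr mi] : measurable_fun Rpos (fun t => Re (mellin_integrand h (s + d) t +
    -1 * mellin_integrand h s t + - d * D t)) /\
    measurable_fun Rpos (fun t => Im (mellin_integrand h (s + d) t +
    -1 * mellin_integrand h s t + - d * D t)).
  by case: h5i => /integrableP[/measurable_EFinP ? _] /integrableP[/measurable_EFinP ? _].
have [] := cintegrable_le mr mi gdi.
  by move=> t t0; rewrite -ERem// mulrC; exact: normRem.
move=> _ /le_trans; apply.
by rewrite gdE mulrCA mulrC.
Qed.

End MellinTransform.

(** * Euler's integral and its functional equation *)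

Lemma near_norm_derivable (K : numFieldType) (f g : K^o -> K^o) (s e : K) :
  0 < e -> (forall z : K, `|z - s| < e -> f z = g z) ->
  derivable f s 1 -> derivable g s 1.
Proof.
move=> e0 fg; apply: near_eq_derivable.
near=> z; apply: fg; rewrite distrC.
near: z; exact: cvgr_dist_lt.
Unshelve. all: by end_near. Qed.

Section Holomorphic.
Context {R : realType}.
Local Notation C := R[i].
Local Notation normc := (@Normc.normc R).
Implicit Types (F G : C -> C) (s : C).

Definition holo F s : Prop := derivable (F : C^o -> C^o) s 1.

Lemma holo_near F G s (e : R) : 0 < e ->
  (forall z, normc (z - s) < e -> F z = G z) -> holo F s -> holo G s.
Proof.
move=> e0 FG; apply: (@near_norm_derivable C F G s e%:C); first by rewrite ltcR.
by move=> z; rewrite normr_complex ltcR; exact: FG.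
Qed.

Lemma holo_cst c s : holo (fun=> c) s.
Proof. exact: derivable_cst. Qed.

Lemma holo_id s : holo id s.
Proof. exact: derivable_id. Qed.

Lemma holoD F G s : holo F s -> holo G s -> holo (fun z => F z + G z) s.
Proof. exact: derivableD. Qed.

Lemma holoM F G s : holo F s -> holo G s -> holo (fun z => F z * G z) s.
Proof. exact: (@derivableM C C^o). Qed.

Lemma holoV F s : F s != 0 -> holo F s -> holo (fun z => (F z)^-1) s.
Proof. exact: (@derivableV C C^o). Qed.

Lemma holo_shift F s c : holo F (s + c) -> holo (fun z => F (z + c)) s.
Proof.
rewrite /holo /derivable /=.
by under [X in _ -> cvg (X @ _)]eq_fun => h do rewrite -addrA.
Qed.

Lemma holo_sum (I : Type) (r : seq I) (F : I -> C -> C) s :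
  (forall i, holo (F i) s) -> holo (fun z => \sum_(i <- r) F i z) s.
Proof.
move=> hF; elim: r => [|i r IH].
  rewrite (_ : (fun z => _) = (fun=> 0)); first exact: holo_cst.
  by apply/funext => z; rewrite big_nil.
rewrite (_ : (fun z => _) = (fun z => F i z + \sum_(j <- r) F j z)).
  exact: (holoD (hF i) IH).
by apply/funext => z; rewrite big_cons.
Qed.

Lemma holo_prod (I : Type) (r : seq I) (F : I -> C -> C) s :
  (forall i, holo (F i) s) -> holo (fun z => \prod_(i <- r) F i z) s.
Proof.
move=> hF; elim: r => [|i r IH].
  rewrite (_ : (fun z => _) = (fun=> 1)); first exact: holo_cst.
  by apply/funext => z; rewrite big_nil.
rewrite (_ : (fun z => _) = (fun z => F i z * \prod_(j <- r) F j z)).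
  exact: (holoM (hF i) IH).
by apply/funext => z; rewrite big_cons.
Qed.

End Holomorphic.

Section EulerIntegral.
Context {R : realType}.
Local Notation C := R[i].
Local Notation mu := (@lebesgue_measure R).
Local Notation Rpos := (`](0 : R), +oo[%classic : set R).
Local Notation Re := (@complex.Re R).
Local Notation Im := (@complex.Im R).
Local Notation normc := (@Normc.normc R).
Local Notation E := (@Euler_integral R).
Implicit Types (s z : C) (a b c t : R).

Lemma of_order_expRN : of_order 0 (fun t => expR (- t)).
Proof.
split.
  apply: measurable_funTS; apply: continuous_measurable_fun => t.
  apply: continuous_comp; last exact: continuous_expR.
  exact: opp_continuous.
exists 1, 1; split => // t t0.
by rewrite /weight mul0r add0r !mul1r ger0_norm// expR_ge0.
Qed.

Lemma holo_Euler s : 0 < Re s -> holo E s.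
Proof. by move=> s0; apply: (mellin_derivable of_order_expRN); rewrite oppr0. Qed.

Lemma cvg_expRN_ln c : 0 < c -> expR (- (c * ln n.+2%:R)) @[n --> \oo] --> (0 : R).
Proof.
move=> c0; apply/cvgrPdist_le => /= e e0; near=> n.
rewrite sub0r normrN ger0_norm ?expR_ge0//.
rewrite -[leRHS](@lnK R) ?posrE// ler_expR lerNl -ler_pdivrMl// mulrC.
rewrite -[leLHS](@expRK R) ler_ln ?posrE ?expR_gt0//.
apply: (@le_trans _ _ n%:R); last by rewrite ler_nat ltnW.
by near: n; exact: nbhs_infty_ger.
Unshelve. all: by end_near. Qed.

Lemma cvg0_le (u w : R^nat) : (forall n, `|u n| <= w n) ->
  w @ \oo --> (0 : R) -> u @ \oo --> (0 : R).
Proof.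
move=> uw w0; apply/norm_cvg0P.
apply: (@squeeze_cvgr _ _ _ _ (cst 0) w) w0; last exact: cvg_cst.
by near=> n; rewrite normr_ge0 uw.
Unshelve. all: by end_near. Qed.

Lemma weight_cvg0 c : 0 < c ->
  weight c 1 n.+2%:R^-1 @[n --> \oo] --> (0 : R) /\
  weight c 1 n.+2%:R @[n --> \oo] --> (0 : R).
Proof.
move=> c0; split.
  apply: cvg0_le (cvg_expRN_ln c0) => n.
  rewrite ger0_norm ?expR_ge0// /weight ler_expR lnV ?posrE ?ltr0n// mulrN.
  by rewrite gerDl oppr_le0 mulr_ge0// invr_ge0.
have [K K0 KE] := @expR_ln_le R (c + 1) 1 ltac:(lra) ltr01.
have Kc : (fun n => K * expR (- (1 * ln n.+2%:R))) @ \oo --> (0 : R).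
  rewrite -[X in _ --> X](mulr0 K); apply: cvgM; first exact: cvg_cst.
  exact: cvg_expRN_ln.
apply: cvg0_le Kc => n; rewrite ger0_norm ?expR_ge0// /weight.
have n0 : 0 < n.+2%:R :> R by [].
have := KE _ n0; rewrite -(ler_pM2r (expR_gt0 (- (1 * n.+2%:R) - 1 * ln n.+2%:R))).
rewrite -expRD -mulrA -expRD.
rewrite (_ : (c + 1) * _ + _ = c * ln n.+2%:R - 1 * n.+2%:R); last by ring.
by rewrite (_ : 1 * n.+2%:R + _ = - (1 * ln n.+2%:R))//; ring.
Qed.

Lemma derivable_continuous_for (f : R -> R) t d :
  is_derive t (1 : R) f d -> {for t, continuous f}.
Proof.
by move=> D; apply/differentiable_continuous/derivable1_diffP; have [] := D.
Qed.

Lemma is_derive_weight a b t : 0 < t ->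
  is_derive t (1 : R) (weight a b) (weight a b t * (a / t - b)).
Proof.
move=> t0; apply: (@is_derive1_comp _ expR (fun r => a * ln r - b * r)).
have D1 : is_derive t (1 : R) (a \*: (@ln R)) (a *: t^-1).
  by apply: is_deriveZ; exact: is_derive1_ln.
have D2 : is_derive t (1 : R) (b \*: id) (b *: 1) by exact: is_deriveZ.
have D := is_deriveB D1 D2.
by rewrite [b *: 1]mulr1 in D; exact: D.
Qed.

Lemma is_derive_trig_ln c t : 0 < t ->
  is_derive t (1 : R) (fun r => cos (c * ln r)) (- sin (c * ln t) * (c / t)) /\
  is_derive t (1 : R) (fun r => sin (c * ln r)) (cos (c * ln t) * (c / t)).
Proof.
move=> t0.
have D : is_derive t (1 : R) (c \*: (@ln R)) (c *: t^-1).
  by apply: is_deriveZ; exact: is_derive1_ln.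
split.
  by apply: (@is_derive1_comp _ cos (fun r => c * ln r)); exact: D.
by apply: (@is_derive1_comp _ sin (fun r => c * ln r)); exact: D.
Qed.

Lemma cvg0_bounded_mul (u w : R^nat) : u @ \oo --> (0 : R) ->
  (forall n, `|w n| <= 1) -> (fun n => u n * w n) @ \oo --> (0 : R).
Proof.
move=> u0 w1.
have un0 : (fun n => `|u n|) @ \oo --> (0 : R) by apply/norm_cvg0P.
apply: cvg0_le un0 => n.
by rewrite normrM ler_piMr.
Qed.

(** The integrand is the derivative of t^a e^{-t} w(t), which vanishes at both ends
    of the half-line. The functional equation of Gamma is the sum of the cases
    where w is the cosine and the sine of a multiple of ln t. *)
Lemma integral_derive_weight a (w dw : R -> R) : 0 < a ->
  (forall t, 0 < t -> is_derive t (1 : R) w (dw t / t)) ->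
  (forall t, 0 < t -> {for t, continuous dw}) -> (forall t, `|w t| <= 1) ->
  mu.-integrable Rpos (EFin \o
    (fun t => weight a 1 t * (a / t - 1) * w t + weight a 1 t * (dw t / t))) ->
  \int[mu]_(t in Rpos)
    (weight a 1 t * (a / t - 1) * w t + weight a 1 t * (dw t / t)) = 0.
Proof.
move=> a0 dwE dwc w1 fi.
have [c1 c2] := weight_cvg0 a0.
set f := fun t => _ in fi *.
pose F t := weight a 1 t * w t.
have dF t : 0 < t -> is_derive t (1 : R) F (f t).
  move=> t0.
  have D := @is_deriveM R R^o _ _ _ _ _ _ (is_derive_weight a 1 t0) (dwE t t0).
  apply: (is_derive_eq D); rewrite /f /GRing.scale /=.
  by rewrite addrC [w t * _]mulrC.
have cf t : 0 < t -> {for t, continuous f}.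
  move=> t0.
  have cW := derivable_continuous_for (is_derive_weight a 1 t0).
  have cw := derivable_continuous_for (dwE t t0).
  have cV : {for t, continuous (fun r : R => r^-1)}.
    by apply: inv_continuous; rewrite gt_eqF.
  apply: continuousD; apply: continuousM => //.
    apply: continuousM => //; apply: continuousB; last exact: cst_continuous.
    by apply: continuousM => //; exact: cst_continuous.
  by apply: continuousM => //; exact: dwc.
have F1 := @cvg0_bounded_mul _ (fun n => w n.+2%:R^-1) c1 (fun n => w1 n.+2%:R^-1).
have F2 := @cvg0_bounded_mul _ (fun n => w n.+2%:R) c2 (fun n => w1 n.+2%:R).
by rewrite (improper_FTC dF cf fi F1 F2) subrr.
Qed.

(** Integration by parts: the derivative of e^{-t} t^s is
    s e^{-t} t^(s-1) - e^{-t} t^s. *)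
Lemma Euler_rec s : 0 < Re s -> E (s + 1) = s * E s.
Proof.
move=> s0; pose m z t : C := (expR (- t))%:C * cpow t (z - 1).
have s0' : - 0%:R < Re s by rewrite oppr0.
have s1' : - 0%:R < Re (s + 1) by rewrite oppr0 ReD /=; lra.
have i0 : cintegrable Rpos (m s) := mellin_cintegrable of_order_expRN s0'.
have i1 : cintegrable Rpos (m (s + 1)) := mellin_cintegrable of_order_expRN s1'.
have [i2 E2] := cintegrableZ s i0.
have [i3 E3] := cintegrableZ (-1) i1.
have [i4 E4] := cintegrableD i2 i3.
apply/eqP; rewrite eq_sym -subr_eq0 -mulN1r -[E s]/(cintegral Rpos (m s)).
rewrite -[E (s + 1)]/(cintegral Rpos (m (s + 1))) -E2 -E3 -E4.
pose a := Re s; pose b := Im s.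
pose fR t := weight a 1 t * (a / t - 1) * cos (b * ln t) +
   weight a 1 t * (- sin (b * ln t) * b / t).
pose fI t := weight a 1 t * (a / t - 1) * sin (b * ln t) +
   weight a 1 t * (cos (b * ln t) * b / t).
have mE t : 0 < t -> s * m s t + -1 * m (s + 1) t = fR t +i* fI t.
  move=> t0.
  have tn0 : t != 0 by rewrite gt_eqF.
  have p1 : m (s + 1) t = (weight a 1 t * cos (b * ln t)) +i* (weight a 1 t * sin (b * ln t)).
    rewrite /m addrK cpowE// /cexp Re_realM Im_realM /weight.
    rewrite [ln t * Re s]mulrC [ln t * Im s]mulrC expRD mul1r -/a -/b.
    by apply/eqP; rewrite eq_complex /= !mul0r !subr0 !addr0 mulrCA !mulrA
      [expR (- t) * _]mulrC !eqxx.
  have p2 : m s t = (t^-1)%:C * m (s + 1) t.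
    rewrite /m addrK [(t^-1)%:C * _]mulrCA; congr (_ * _).
    rewrite -[in RHS](subrK 1 s) (cpowD (s - 1) 1 t0) cpow1// mulrCA -rmorphM.
    by rewrite mulVf// mulr1.
  rewrite p2 p1 /fR /fI -/a; apply/eqP; rewrite eq_complex !(ReD, ImD, ReM, ImM) /=.
  by rewrite -/a -/b; apply/andP; split; apply/eqP; field.
have i5 := eq_cintegrable mE i4.
rewrite (eq_cintegral mE) /cintegral eq_complex /=.
have trigc (t : R) : 0 < t -> {for t, continuous (fun r => - sin (b * ln r) * b)} /\
    {for t, continuous (fun r => cos (b * ln r) * b)}.
  move=> t0; have [D1 D2] := is_derive_trig_ln b t0.
  split; apply: continuousM; try exact: cst_continuous.
    by apply: continuousN; exact: derivable_continuous_for D2.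
  exact: derivable_continuous_for D1.
apply/andP; split; apply/eqP.
- apply: (@integral_derive_weight a (fun t => cos (b * ln t))
    (fun t => - sin (b * ln t) * b)) => //; last by case: i5.
  + by move=> t t0; rewrite -mulrA; case: (is_derive_trig_ln b t0).
  + by move=> t /trigc[].
  + by move=> t; exact: cos_max.
- apply: (@integral_derive_weight a (fun t => sin (b * ln t))
    (fun t => cos (b * ln t) * b)) => //; last by case: i5.
  + by move=> t t0; rewrite -mulrA; case: (is_derive_trig_ln b t0).
  + by move=> t /trigc[].
  + by move=> t; exact: sin_max.
Qed.

End EulerIntegral.

(** * The reciprocal of the Gamma function *)

Section GammaNonvanishing.
Context {R : realType}.
Local Notation C := R[i].
Local Notation mu := (@lebesgue_measure R).
Local Notation Rpos := (`](0 : R), +oo[%classic : set R).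
Local Notation Re := (@complex.Re R).
Local Notation Im := (@complex.Im R).
Local Notation normc := (@Normc.normc R).
Local Notation E := (@Euler_integral R).
Implicit Types (s z : C) (a b c t : R).

Definition Gamma_succ a : R := \int[mu]_(t in Rpos) weight a 1 t.

Lemma weight_int a : -1 < a -> mu.-integrable Rpos (EFin \o weight a (1 : R)).
Proof. by move=> a1; exact: weight_integrable. Qed.

Lemma Euler_realE a : E (a + 1)%:C = (Gamma_succ a)%:C.
Proof.
rewrite /Euler_integral (@eq_cintegral _ _ (fun t => (weight a 1 t)%:C)).
  rewrite /cintegral /= /Gamma_succ; congr (_ +i* _).
  by rewrite /Rintegral integral0.
move=> t t0; rewrite cpowE// /cexp Re_realM Im_realM ReD ImD ReN ImN /=.
rewrite addrK subr0 mulr0 cos0 sin0 /weight mulr1.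
by rewrite expRD mulrC mul1r [a * _]mulrC rmorphM.
Qed.

Lemma Gamma_succ_rec a : -1 < a -> Gamma_succ (a + 1) = (a + 1) * Gamma_succ a.
Proof.
move=> a1; have := @Euler_rec R (a + 1)%:C.
rewrite /= -ltrBlDr sub0r => /(_ a1).
rewrite (_ : (a + 1)%:C + 1 = (a + 1 + 1)%:C); last by rewrite [RHS]rmorphD.
by rewrite !Euler_realE -rmorphM => /complexI.
Qed.

Lemma Gamma_succ0 : Gamma_succ 0 = 1.
Proof.
pose F t : R := - weight 0 1 t.
have FE t : F t = - expR (- t) by rewrite /F /weight mul0r add0r mul1r.
have dF t : 0 < t -> is_derive t (1 : R) F (weight 0 1 t).
  move=> t0; have D := is_deriveN (is_derive_weight 0 1 t0).
  by apply: (is_derive_eq D); rewrite mul0r add0r mulrN1 opprK.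
have cf t : 0 < t -> {for t, continuous (weight 0 (1 : R))}.
  move=> t0; exact: (derivable_continuous_for (is_derive_weight 0 1 t0)).
have h2 : F n.+2%:R @[n --> \oo] --> (0 : R).
  rewrite (_ : (fun n => _) = (fun n => - expR (- n.+2%:R))); last first.
    by apply/funext => n; rewrite FE.
  rewrite -[X in _ --> X]oppr0; apply: cvgN.
  have := @cvgn_expR R; rewrite -(cvg_shiftn 2) /=.
  by under eq_fun do rewrite addn2.
have h1 : F n.+2%:R^-1 @[n --> \oo] --> (-1 : R).
  rewrite (_ : (fun n => _) = (fun n => - expR (- n.+2%:R^-1))); last first.
    by apply/funext => n; rewrite FE.
  apply: cvgN; rewrite -[X in _ --> X]expR0.
  have g0 : (fun n => - n.+2%:R^-1) @ \oo --> (0 : R).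
    rewrite -[X in _ --> X]oppr0; apply: cvgN.
    by have := @cvg_harmonic R; rewrite -cvg_shiftS.
  exact: (cvg_comp _ _ g0 (@continuous_expR R 0)).
rewrite /Gamma_succ (improper_FTC dF cf _ h1 h2) ?sub0r ?opprK//.
by apply: weight_int; rewrite ltrN10.
Qed.

(** Bernoulli's inequality t^a >= a t - (a - 1), integrated against e^{-t}, gives
    a Gamma(2) - (a - 1) Gamma(1) = 1 as a lower bound. *)
Lemma Gamma_succ_ge1 a : 1 <= a -> 1 <= Gamma_succ a.
Proof.
move=> a1; have a0 : 0 <= a - 1 by lra.
have w0 : mu.-integrable Rpos (EFin \o weight 0 (1 : R)).
  by apply: weight_int; rewrite ltrN10.
have w1 : mu.-integrable Rpos (EFin \o weight 1 (1 : R)) by apply: weight_int; lra.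
have wa : mu.-integrable Rpos (EFin \o weight a (1 : R)) by apply: weight_int; lra.
have [i1 e1] := halfline_integrableZ a w1.
have [i0 e0] := halfline_integrableZ (- (a - 1)) w0.
have [i2 e2] := halfline_integrableD i1 i0.
have <- : \int[mu]_(t in Rpos) (a * weight 1 1 t + - (a - 1) * weight 0 1 t) = 1.
  have E0 : \int[mu]_(t in Rpos) weight 0 1 t = 1 := Gamma_succ0.
  have E1 : \int[mu]_(t in Rpos) weight 1 1 t = 1.
    by have := @Gamma_succ_rec 0 (ltrN10 R); rewrite add0r Gamma_succ0 mulr1.
  by rewrite e2 e1 e0 E0 E1; ring.
apply: halfline_le => // t t0.
rewrite /weight !mul1r mul0r add0r !expRD !mulrA -mulrDl ler_wpM2r ?expR_ge0//.
set r := ln t; have er := expR_gt0 r.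
have h1 := expR_ge1Dx ((a - 1) * r).
have h2 := expR_ge1Dx (- r); have h3 := expRxMexpNx_1 r.
have -> : expR (a * r) = expR r * expR ((a - 1) * r).
  by rewrite -expRD; congr expR; rewrite mulrBl mul1r addrCA subrr addr0.
have h4 : expR r * (1 - r) <= 1.
  by rewrite -[leRHS]h3 ler_wpM2l// ltW.
apply: (@le_trans _ _ (expR r * (1 + (a - 1) * r))); last by rewrite ler_wpM2l// ltW.
move: (ler_wpM2l a0 h4); clear; set e := expR r; lra.
Qed.

(** With t = e^{2u} the right-hand side is 4 (e^u - e^{-u})^2, and
    |u| <= |e^u - e^{-u}|. *)
Lemma sqr_ln_le t : 0 < t -> ln t ^+ 2 <= 4 * (t + t^-1 - 2).
Proof.
move=> t0; pose u := ln t / 2.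
have e1 : t = expR u ^+ 2.
  by rewrite -expRM_natl /u mulrCA divff// mulr1 lnK.
have -> : t + t^-1 - 2 = (expR u - expR (- u)) ^+ 2.
  rewrite e1 sqrrB expRxMexpNx_1 expRN exprVn; ring.
have lu : ln t = 2 * u by rewrite /u mulrCA divff// mulr1.
rewrite lu exprMn (_ : 2 ^+ 2 = 4); last by ring.
rewrite ler_pM2l// -[leLHS]sqr_norm -[leRHS]sqr_norm lerXn2r ?nnegrE//.
wlog u0 : u {e1 lu} / 0 <= u.
  move=> H; have [/H//|/ltW u0] := leP 0 u.
  by have := H (- u); rewrite oppr_ge0 opprK normrN distrC; apply.
have h1 := expR_ge1Dx u; have h2 : expR (- u) <= 1 by rewrite expR_le1 oppr_le0.
by rewrite !ger0_norm//; lra.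
Qed.

(** Let s = a + i tau. For the Gamma distribution of parameter a, the variable
    y = t / a concentrates around 1 when a is large, so that y^(i tau) cannot
    average to 0. Quantitatively,
    1 - cos(tau ln y) <= (tau ln y)^2 <= 4 tau^2 (y + 1/y - 2),
    and y and 1/y have means 1 and a / (a - 1), so the real part of
    a^(-i tau) Gamma(s) / Gamma(a) is at least 1 - 4 tau^2 / (a - 1) > 0. *)
Lemma Euler_neq0_large s : 2 < Re s -> 4 * Im s ^+ 2 + 1 < Re s -> E s != 0.
Proof.
move=> s2 sI; apply/negP => /eqP Es0.
pose al := Re s - 1; pose tau := Im s; pose a := Re s.
have al1 : 1 < al by rewrite /al; lra.
have altau : 4 * tau ^+ 2 < al by rewrite /al /tau; lra.
have a0 : 0 < a by rewrite /a; lra.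
have alP : -1 < al by lra.
have alN : -1 < al - 1 by lra.
have alS : -1 < al + 1 by lra.
have al0 : 0 < al by lra.
have alS0 : al + 1 != 0 by rewrite gt_eqF//; lra.
pose m t : C := (expR (- t))%:C * cpow t (s - 1).
have s0 : - 0%:R < Re s by rewrite oppr0; lra.
have [mR mI] : cintegrable Rpos m := mellin_cintegrable of_order_expRN s0.
have /eqP : cintegral Rpos m = 0 := Es0.
rewrite /cintegral eq_complex /= => /andP[/eqP IR /eqP II].
have mE t : 0 < t -> Re (m t) = weight al 1 t * cos (tau * ln t) /\
    Im (m t) = weight al 1 t * sin (tau * ln t).
  move=> t0; rewrite /m cpowE// /cexp !Re_realM !Im_realM ReD ImD ReN ImN /=.
  rewrite subr0 -/al -/tau /weight mul1r expRD !mulrA [ln t * al]mulrC.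
  by rewrite [ln t * tau]mulrC [expR (- t) * _]mulrC.
(* Real part of a^(-i tau) times the integrand; its integral is 0. *)
have [i1 e1] := halfline_integrableZ (cos (tau * ln a)) mR.
have [i2 e2] := halfline_integrableZ (sin (tau * ln a)) mI.
have [i3 e3] := halfline_integrableD i1 i2.
rewrite e1 e2 IR II !mulr0 addr0 in e3.
have w0 := weight_int alP; have w1 := weight_int alS; have w2 := weight_int alN.
have [j0 f0] := halfline_integrableZ (1 + 8 * tau ^+ 2) w0.
have [j1 f1] := halfline_integrableZ (- (4 * tau ^+ 2 / a)) w1.
have [j2 f2] := halfline_integrableZ (- (4 * tau ^+ 2 * a)) w2.
have [j3 f3] := halfline_integrableD j1 j2.
have [j4 f4] := halfline_integrableD j0 j3.
have := halfline_le j4 i3; rewrite e3 f4 f3 f0 f1 f2.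
have Ga : \int[mu]_(t in Rpos) weight (al + 1) 1 t = (al + 1) * Gamma_succ al := Gamma_succ_rec alP.
have Gb : Gamma_succ al = al * \int[mu]_(t in Rpos) weight (al - 1) 1 t.
  by have := Gamma_succ_rec alN; rewrite subrK.
have G1 := Gamma_succ_ge1 (ltW al1).
rewrite Ga -/(Gamma_succ al).
rewrite (_ : \int[mu]_(t in Rpos) weight (al - 1) 1 t = Gamma_succ al / al); last first.
  by rewrite Gb mulrC mulKf// gt_eqF.
move=> H.
have : Gamma_succ al * (1 - 4 * tau ^+ 2 / al) <= 0.
  apply: (le_trans _ (H _)).
    rewrite /a (_ : Re s = al + 1); last by rewrite /al subrK.
    rewrite le_eqVlt; apply/orP; left; apply/eqP; field.
    by rewrite alS0 gt_eqF.
  move=> t t0; have [-> ->] := mE t t0.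
  have -> : cos (tau * ln a) * (weight al 1 t * cos (tau * ln t)) +
      sin (tau * ln a) * (weight al 1 t * sin (tau * ln t)) =
      weight al 1 t * cos (tau * ln t - tau * ln a).
    by rewrite cosB; ring.
  rewrite -[weight (al - 1) 1 t](weightM al 1 (-1)) -(weightM al 1 1).
  rewrite mul1r mulN1r expRN lnK ?posrE//.
  rewrite [leLHS](_ : _ = weight al 1 t * (1 - 4 * tau ^+ 2 * (t / a + a / t - 2))); last first.
    by field; rewrite !gt_eqF.
  rewrite ler_wpM2l ?expR_ge0//.
  have -> : tau * ln t - tau * ln a = tau * ln (t / a).
    by rewrite ln_div ?posrE// mulrBr.
  have h1 := oneBcos_le (tau * ln (t / a)).
  have h2 := sqr_ln_le (divr_gt0 t0 a0).
  rewrite exprMn in h1; rewrite invf_div in h2.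
  have := ler_wpM2l (sqr_ge0 tau) h2; move: h1; clear; lra.
apply/negP; rewrite -ltNge mulr_gt0//; first exact: lt_le_trans G1.
by rewrite subr_gt0 ltr_pdivrMr ?mul1r.
Qed.

Lemma Euler_shift s n : 0 < Re s ->
  E (s + n%:R) = \prod_(i < n) (s + i%:R) * E s.
Proof.
move=> s0; elim: n => [|n IH]; first by rewrite addr0 big_ord0 mul1r.
rewrite mulrSr addrA Euler_rec; last by rewrite ReD Re_nat ltr_wpDr.
by rewrite IH big_ord_recr /= mulrA [_ * (s + _)]mulrC.
Qed.

(** The functional equation carries a zero at s to s + n for every n. *)
Lemma Euler_neq0 s : 0 < Re s -> E s != 0.
Proof.
move=> s0; apply/eqP => Es0.
pose n := (Num.truncn (4 * Im s ^+ 2 + 3)).+1.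
have nE : 4 * Im s ^+ 2 + 3 < n%:R by exact: truncnS_gt.
have sq := sqr_ge0 (Im s).
have : E (s + n%:R) != 0.
  by apply: Euler_neq0_large; rewrite !ReD Re_nat ?ImD ?Im_nat ?addr0; lra.
by rewrite Euler_shift// Es0 mulr0 eqxx.
Qed.

(** 1 / Gamma through the integral at s + n: one formula on the half-plane
    Re s > -n, and independent of n there. *)
Definition rGamma n s : C := \prod_(i < n) (s + i%:R) / E (s + n%:R).

Lemma rGammaS n s : 0 < Re s + n%:R -> rGamma n.+1 s = rGamma n s.
Proof.
move=> sn; have sn' : 0 < Re (s + n%:R) by rewrite ReD Re_nat.
have s0 : s + n%:R != 0.
  by apply: contraTneq sn' => ->; rewrite ltxx.
rewrite /rGamma mulrSr addrA Euler_rec// big_ord_recr /= invfM mulrA.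
by congr (_ / _); rewrite mulfK.
Qed.

Lemma rGamma_indep n m s : 0 < Re s + n%:R -> 0 < Re s + m%:R ->
  rGamma n s = rGamma m s.
Proof.
wlog nm : n m / (n <= m)%N.
  move=> H; case: (leqP n m) => [/H//|/ltnW mn] h1 h2.
  by rewrite [RHS](H m n mn).
move=> h1 _; rewrite -(subnKC nm); elim: (m - n)%N => [|k IH]; first by rewrite addn0.
rewrite addnS rGammaS// natrD addrA ltr_wpDr//.
Qed.

Lemma Gamma_inv n s : 0 < Re s + n%:R -> (Gamma s)^-1 = rGamma n s.
Proof.
move=> sn; rewrite /Gamma invf_div -/(rGamma (Gamma_shift s) s).
apply: rGamma_indep => //; rewrite /Gamma_shift; case: ifPn => s0; first by rewrite addr0.
by rewrite addrC -ltrBlDr sub0r truncnS_gt.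
Qed.

Lemma holo_rGamma n s : 0 < Re s + n%:R -> holo (rGamma n) s.
Proof.
move=> sn; have sn' : 0 < Re (s + n%:R) by rewrite ReD Re_nat.
apply: holoM.
  by apply: holo_prod => i; apply: holoD; [exact: holo_id|exact: holo_cst].
apply: holoV; first exact: Euler_neq0.
by apply: holo_shift; exact: holo_Euler.
Qed.

Lemma rGamma_neg n m : (m < n)%N -> rGamma n (- m%:R) = 0.
Proof.
move=> mn; rewrite /rGamma (bigD1 (Ordinal mn))//= addNr !mul0r//.
Qed.

(** Gamma(s + m) / Gamma(s), as a polynomial in s. *)
Lemma rGamma_Euler n m s : 0 < Re s + n%:R -> 0 < Re s + m%:R ->
  rGamma n s * E (s + m%:R) = \prod_(i < m) (s + i%:R).
Proof.
move=> sn sm; rewrite (rGamma_indep sn sm) /rGamma divfK//.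
by apply: Euler_neq0; rewrite ReD Re_nat.
Qed.

End GammaNonvanishing.

(** * Power series and powers of 1 - exp(-t) *)

Section PowerSeries.
Context {R : realType}.
Implicit Types (a e : R^nat) (t q K y : R).

Lemma expR_series t : series (fun m => t ^+ m / m`!%:R) @ \oo --> expR t.
Proof. exact: (@is_cvg_series_exp_coeff R t). Qed.

Lemma exp_partial_le t n : 0 <= t -> \sum_(m < n) t ^+ m / m`!%:R <= expR t.
Proof.
move=> t0; have -> : \sum_(m < n) t ^+ m / m`!%:R = series (exp_coeff t) n.
  by rewrite seriesEord.
apply: nondecreasing_cvgn_le; last exact: is_cvg_series_exp_coeff.
apply/nondecreasing_seqP => m.
by rewrite !seriesEord /= big_ord_recr /= lerDl divr_ge0// exprn_ge0.
Qed.

(** The factor 2 bounds 1 / (1 - q). *)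
Lemma series_tail a f K q N : 0 <= K -> 0 <= q <= 2^-1 ->
  (forall m, `|a m| <= K * q ^+ m) -> series a @ \oo --> f ->
  `|f - \sum_(m < N) a m| <= 2 * K * q ^+ N.
Proof.
move=> K0 /andP[q0 q2] aK af.
have step d : `|series a (N + d)%N - series a N| <= 2 * K * (q ^+ N - q ^+ (N + d)).
  elim: d => [|d IH]; first by rewrite addn0 !subrr normr0 mulr0.
  rewrite addnS seriesSr addrAC; apply: le_trans (ler_normD _ _) _.
  apply: le_trans (lerD IH (aK _)) _; rewrite exprS.
  have := mulr_ge0 K0 (exprn_ge0 (N + d) q0).
  set Q := q ^+ (N + d) => KQ.
  have h : 0 <= K * Q * (1 - 2 * q) by rewrite mulr_ge0//; lra.
  lra.
have -> : \sum_(m < N) a m = series a N by rewrite seriesEord.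
have h : `|series a n - series a N| @[n --> \oo] --> `|f - series a N|.
  by apply: cvg_norm; apply: cvgB => //; exact: cvg_cst.
rewrite -(cvg_lim _ h)//; apply: limr_le; first by apply: cvgP h.
near=> n; have Nn : (N <= n)%N by near: n; exact: nbhs_infty_ge.
rewrite -(subnKC Nn); apply: (le_trans (step _)).
by rewrite ler_wpM2l ?mulr_ge0// gerBl exprn_ge0.
Unshelve. all: by end_near. Qed.

(** At the first non-zero coefficient e_m, the series would be e_m t^m + O(t^(m+1)),
    so that |e_m| is at most a multiple of t for all small t > 0. *)
Lemma pseries_unique e :
  (\forall t \near (0 : R)^', series (fun m => e m * t ^+ m) @ \oo --> (0 : R)) ->
  forall m, e m = 0.
Proof.
move=> /nbhs_ballP[r /= r0 er].
have er' t : t != 0 -> `|t| < r -> series (fun m => e m * t ^+ m) @ \oo --> (0 : R).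
  by move=> t0 tr; apply: er => //; rewrite /ball /= sub0r normrN.
pose s := r / 2; have s0 : 0 < s by rewrite divr_gt0.
have sr : `|s| < r by rewrite gtr0_norm// /s; lra.
have sn0 : s != 0 by rewrite gt_eqF.
have /cvg_seq_bounded [M [_ /(_ (M + 1))]] : cvgn (fun m => e m * s ^+ m).
  apply: cvgP; apply: cvg_series_cvg_0; apply: cvgP; exact: er' sn0 sr.
rewrite ltrDl ltr01 => /(_ isT) /= eM.
pose K := `|M + 1|.
have eK m : `|e m| * s ^+ m <= K.
  have := eM m I; rewrite normrM normrX (gtr0_norm s0) => /le_trans; apply.
  exact: ler_norm.
move=> m; elim/ltn_ind: m => m IH; apply/eqP/negP => /negP em0.
have bound t : 0 < t -> t <= s / 2 -> `|e m| * s ^+ m.+1 <= 2 * K * t.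
  move=> t0 ts.
  have tr : `|t| < r by rewrite gtr0_norm//; move: ts; rewrite /s; lra.
  have q2 : 0 <= t / s <= 2^-1.
    apply/andP; split; first by rewrite divr_ge0// ltW.
    by rewrite ler_pdivrMr// mulrC.
  have h : forall j, `|e j * t ^+ j| <= K * (t / s) ^+ j.
    move=> j; rewrite normrM normrX (gtr0_norm t0) expr_div_n mulrA.
    rewrite ler_pdivlMr ?exprn_gt0// mulrAC ler_wpM2r// exprn_ge0// ltW//.
  have := @series_tail _ 0 K (t / s) m.+1 (normr_ge0 _) q2 h (er' t _ tr).
  rewrite gt_eqF// => /(_ isT).
  rewrite big_ord_recr /= big1 ?add0r; last by move=> i _; rewrite IH// mul0r.
  rewrite normrN normrM normrX (gtr0_norm t0) expr_div_n.
  rewrite mulrA ler_pdivlMr ?exprn_gt0// [t ^+ m.+1]exprS => h2.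
  rewrite -(ler_pM2r (exprn_gt0 m t0)); move: h2; clear.
  by set S := s ^+ _; set T := t ^+ m; lra.
have emp : 0 < `|e m| * s ^+ m.+1 by rewrite mulr_gt0 ?normr_gt0// exprn_gt0.
set D := `|e m| * _ in bound emp.
have K0 : 0 <= K by exact: normr_ge0.
have K2 : 0 <= 2 * K by rewrite mulr_ge0.
have K1 : 0 < 2 * K + 1 by rewrite ltr_wpDl.
pose t := Num.min (s / 2) (D / (2 * K + 1)).
have t0 : 0 < t by rewrite lt_min !divr_gt0.
have := bound t t0; rewrite ge_min lexx => /(_ isT).
apply/negP; rewrite -ltNge.
apply: (@le_lt_trans _ _ (2 * K * (D / (2 * K + 1)))).
  by rewrite ler_wpM2l// ge_min lexx orbT.
by rewrite mulrCA gtr_pMr// ltr_pdivrMr// mul1r ltrDl.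
Qed.

(** The coefficient of t^m in e^{yt} (1 - e^{-t})^n. Multiplying by 1 - e^{-t}
    amounts to a backward difference in y. *)
Fixpoint fdiff n y m : R :=
  if n is n'.+1 then fdiff n' y m - fdiff n' (y - 1) m else y ^+ m / m`!%:R.

Lemma fdiff_series n y t :
  series (fun m => fdiff n y m * t ^+ m) @ \oo --> expR (y * t) * (1 - expR (- t)) ^+ n.
Proof.
elim: n y => [|n IH] y /=.
  rewrite mulr1; have := @expR_series (y * t).
  by under [fun m => _]eq_fun do rewrite exprMn mulrAC.
rewrite (_ : series _ = series (fun m => fdiff n y m * t ^+ m) -
    series (fun m => fdiff n (y - 1) m * t ^+ m)); last first.
  apply/funext => N; rewrite !fctE !seriesEord /= -sumrB.
  by apply: eq_bigr => m _; rewrite mulrBl.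
rewrite (_ : _ * _ = expR (y * t) * (1 - expR (- t)) ^+ n -
    expR ((y - 1) * t) * (1 - expR (- t)) ^+ n); first exact: cvgB.
by rewrite mulrBl mul1r expRD exprS; ring.
Qed.

Lemma exp_coef_add y m :
  (y - 1) ^+ m / m`!%:R =
  \sum_(i < m.+1) (y ^+ i / i`!%:R) * ((-1) ^+ (m - i) / (m - i)`!%:R).
Proof.
rewrite addrC exprDn mulr_suml; apply: eq_bigr => i _.
have im : (i <= m)%N by rewrite -ltnS.
have f0 j : j`!%:R != 0 :> R by rewrite pnatr_eq0 -lt0n fact_gt0.
rewrite -(bin_fact im) !natrM -[_ *+ 'C(m, i)]mulr_natr.
have b0 : 'C(m, i)%:R != 0 :> R by rewrite pnatr_eq0 -lt0n bin_gt0.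
by field; rewrite b0 !f0.
Qed.

(** Multiplying by e^{-t} replaces y by y - 1; on coefficients this is a Cauchy
    product with the exponential series. *)
Lemma fdiff_shift n y m :
  fdiff n (y - 1) m =
  \sum_(i < m.+1) fdiff n y i * ((-1) ^+ (m - i) / (m - i)`!%:R).
Proof.
elim: n y => [|n IH] y /=; first exact: exp_coef_add.
by rewrite (IH y) (IH (y - 1)) -sumrB; apply: eq_bigr => i _; rewrite mulrBl.
Qed.

(** The top term of the Cauchy product cancels in the difference: the constant
    coefficient of 1 - e^{-t} is 0. *)
Lemma fdiffS n y m : fdiff n.+1 y m =
  - \sum_(i < m) fdiff n y i * ((-1) ^+ (m - i) / (m - i)`!%:R).
Proof.
rewrite /= fdiff_shift big_ord_recr /= subnn expr0 fact0 divr1 mulr1.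
by rewrite opprD addrCA subrr addr0.
Qed.

Lemma fdiff_small n y m : (m < n)%N -> fdiff n y m = 0.
Proof.
elim: n m => // n IH m mn; rewrite fdiffS big1 ?oppr0// => i _.
by rewrite IH ?mul0r//; apply: leq_trans (ltn_ord i) _.
Qed.

(** Coefficientwise, 1 - e^{-t} is bounded by e^t - 1 and e^{yt} by e^{|y|t}; the
    recursion [fdiffS] propagates the bound through the products. *)
Lemma fdiff_le n y m (r : R) : 0 <= r ->
  `|fdiff n y m| * r ^+ m <= expR (`|y| * r) * (expR r - 1) ^+ n.
Proof.
move=> r0; elim: n m => [|n IH] m.
  rewrite mulr1 /= normrM normrX normfV (ger0_norm (ler0n _ _)) mulrAC -exprMn.
  have := exp_partial_le m.+1 (mulr_ge0 (normr_ge0 y) r0).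
  apply: le_trans; rewrite big_ord_recr /= lerDr; apply: sumr_ge0 => i _.
  by rewrite divr_ge0// exprn_ge0// mulr_ge0.
rewrite fdiffS normrN.
have W0 : 0 <= expR r - 1 by rewrite subr_ge0 le1_expR.
have S_le : \sum_(i < m) r ^+ (m - i) / (m - i)`!%:R <= expR r - 1.
  rewrite (reindex_inj rev_ord_inj) /=.
  rewrite (eq_bigr (fun i : 'I_m => r ^+ i.+1 / i.+1`!%:R)); last first.
    by move=> i _; rewrite subnA ?subnn ?add0n// ltnW.
  have := exp_partial_le m.+1 r0.
  by rewrite big_ord_recl expr0 fact0 divr1 lerBrDl.
apply: (@le_trans _ _ (\sum_(i < m) expR (`|y| * r) * (expR r - 1) ^+ n *
    (r ^+ (m - i) / (m - i)`!%:R))).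
  apply: le_trans (ler_wpM2r _ (ler_norm_sum _ _ _)) _; first exact: exprn_ge0.
  rewrite mulr_suml; apply: ler_sum => i _.
  have -> : r ^+ m = r ^+ i * r ^+ (m - i).
    by rewrite -exprD subnKC// ltnW.
  rewrite normrM normrM normrX normrN1 expr1n mul1r normfV (ger0_norm (ler0n _ _)).
  rewrite mulrACA [(_)^-1 * _]mulrC.
  by rewrite ler_wpM2r ?IH// divr_ge0// exprn_ge0.
rewrite -mulr_sumr [_ ^+ n.+1]exprSr mulrA ler_wpM2l// mulr_ge0 ?expR_ge0//.
exact: exprn_ge0.
Qed.

End PowerSeries.

(** * Multiple polylogarithms *)

Lemma path_ltn_le_last a s x : path ltn a s -> x \in a :: s -> (x <= last a s)%N.
Proof.
elim: s a x => [|b s IH] a x /=; first by rewrite inE => _ /eqP ->.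
case/andP=> ab bs; rewrite inE => /orP[/eqP ->|]; last exact: IH.
by apply: leq_trans (ltnW ab) _; apply: IH => //; rewrite mem_head.
Qed.

Lemma path_ltn_size a s : path ltn a s -> (a + size s <= last a s)%N.
Proof.
elim: s a => [|b s IH] a /=; first by rewrite addn0.
by case/andP=> ab /IH; apply: leq_trans; rewrite addnS -addSn leq_add2r.
Qed.

Section Bernoulli.
Variable R : realType.

Lemma bernoulli_le (a : R) n : 0 <= a <= 1 -> 1 - n%:R * a <= (1 - a) ^+ n.
Proof.
case/andP=> a0 a1; elim: n => [|n IH]; first by rewrite mul0r subr0.
rewrite exprS; apply: (@le_trans _ _ ((1 - a) * (1 - n%:R * a))).
  have n0 : 0 <= n%:R :> R by [].
  by rewrite -natr1; have := mulr_ge0 n0 (sqr_ge0 a); lra.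
by rewrite ler_wpM2l// subr_ge0.
Qed.

(** This is the bound sum_j q^j / j <= - ln (1 - q) in the variable T = - ln (1 - q),
    in which the difference of the two sides has derivative
    (1 - e^{-T})^N >= 0. *)
Lemma log_series_le N (T : R) : 0 <= T ->
  \sum_(j < N.+1) (1 - expR (- T)) ^+ j / j%:R <= T.
Proof.
move=> T0; rewrite -subr_ge0.
pose q (u : R) : R := 1 - expR (- u).
pose g M (u : R) : R := u - \sum_(j < M.+1) q u ^+ j / j%:R.
have dq u : is_derive u (1 : R) q (expR (- u)).
  have D1 : is_derive u (1 : R) (expR \o -%R) (expR (- u) * -1).
    apply: is_derive1_comp; exact: is_deriveN.
  have D2 : is_derive u (1 : R) (cst 1 - (expR \o -%R)) (0 - expR (- u) * -1).
    exact: is_deriveB.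
  by apply: (is_derive_eq D2); rewrite sub0r mulrN1 opprK.
have dg M u : is_derive u (1 : R) (g M) (q u ^+ M).
  elim: M => [|M IH].
    rewrite (_ : g 0 = id); first exact: is_derive_id.
    by apply/funext => r; rewrite /g big_ord_recl big_ord0 invr0 mulr0 addr0 subr0.
  have D1 : is_derive u (1 : R) (q ^+ M.+1) ((M.+1%:R * q u ^+ M) *: expR (- u)).
    exact: is_deriveX.
  have D2 : is_derive u (1 : R) (M.+1%:R^-1 \*: (q ^+ M.+1))
      (M.+1%:R^-1 *: ((M.+1%:R * q u ^+ M) *: expR (- u))) by exact: is_deriveZ.
  have D3 := is_deriveB IH D2.
  rewrite (_ : g M.+1 = g M - M.+1%:R^-1 \*: (q ^+ M.+1)).
    apply: (is_derive_eq D3); rewrite /GRing.scale /=.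
    rewrite mulrA mulKf// exprSr -{1}[q u ^+ M]mulr1 -mulrBr; congr (_ * _).
  apply/funext => r; rewrite /g big_ord_recr /= opprD addrA; congr (_ - _).
  by rewrite mulrC; congr (_ * _); rewrite exprfctE.
apply: (@nonneg_of_derive _ (g N) (fun u => q u ^+ N) (dg N) _ _ _ T0).
  rewrite /g big1 ?subr0// => j _; rewrite /q oppr0 expR0 subrr expr0n.
  by case: (j : nat) => [|n]; rewrite ?invr0 ?mulr0 ?mul0r.
by move=> u u0; rewrite exprn_ge0// /q subr_ge0 expR_le1 oppr_le0.
Qed.

End Bernoulli.

Section Polylog.
Context {R : realType} (k : nat) (v : k.-tuple nat).
Implicit Types (z q t : R) (N : nat).
Hypotheses (k_gt0 : (0 < k)%N) (v_gt0 : forall i : 'I_k, (0 < tnth v i)%N).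

Local Notation vals n := [seq val j | j <- n].
Local Notation Lip := (@Li_partial R k v).

Definition Li_weight N (n : k.-tuple 'I_N) : R :=
  \prod_(i < k) ((tnth n i)%:R ^+ tnth v i).

Lemma Li_weight_ge0 N (n : k.-tuple 'I_N) : 0 <= Li_weight n.
Proof. by apply: prodr_ge0 => i _; exact: exprn_ge0. Qed.

(** The entries of an increasing tuple are bounded by the last one, so the tuples
    whose last entry is not N + 1 are exactly those already counted up to N. *)
Lemma Li_partial_split z N : Lip z N.+1 = Lip z N + z ^+ N.+1 *
  \sum_(n : k.-tuple 'I_N.+2 | path ltn 0%N (vals n) && (last 0%N (vals n) == N.+1))
    (Li_weight n)^-1.
Proof.
rewrite {1}/Li_partial (bigID (fun n : k.-tuple 'I_N.+2 => last 0%N (vals n) == N.+1)) /=.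
rewrite addrC; congr (_ + _); last first.
  by rewrite mulr_sumr; apply: eq_bigr => n /andP[_ /eqP ->].
pose h (n : k.-tuple 'I_N.+1) : k.-tuple 'I_N.+2 := map_tuple (widen_ord (leqnSn N.+1)) n.
pose h' (n : k.-tuple 'I_N.+2) : k.-tuple 'I_N.+1 := map_tuple (fun i => inord (val i)) n.
have valsh (n : k.-tuple 'I_N.+1) : vals (h n) = vals n.
  by rewrite /= -map_comp; apply: eq_map.
have lastN M (n : k.-tuple 'I_M.+1) : (last 0%N (vals n) < M.+1)%N.
  have := mem_last 0%N (vals n); rewrite inE => /orP[/eqP ->//|/mapP[j _ ->]].
  exact: ltn_ord.
rewrite (reindex_onto h h') /=; last first.
  move=> n /andP[pn ln]; apply: eq_from_tnth => i; rewrite !tnth_map.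
  apply: val_inj => /=; rewrite inordK//.
  have : (val (tnth n i) <= last 0 (vals n))%N.
    by apply: path_ltn_le_last => //; rewrite inE map_f ?orbT// mem_tnth.
  move/leq_ltn_trans; apply; rewrite ltn_neqAle ln -ltnS.
  exact: lastN.
apply: eq_big => n.
  rewrite -[h n : seq _]/(tval (h n)) valsh.
  rewrite (_ : h' (h n) == n) ?andbT; last first.
    apply/eqP/eq_from_tnth => i; rewrite !tnth_map; apply: val_inj => /=.
    by rewrite inordK.
  by rewrite (ltn_eqF (lastN _ n)) andbT.
move=> _; rewrite valsh; congr (_ / _); apply: eq_bigr => i _.
by rewrite tnth_map.
Qed.

(** The coefficient of z^(n+1) in Li, the power 0 never occurring, as an
    increment of partial sums at z = 1. *)
Definition Li_coef n : R := Lip 1 n.+1 - Lip 1 n.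

Lemma Li_partialS z N : Lip z N.+1 = Lip z N + Li_coef N * z ^+ N.+1.
Proof.
rewrite /Li_coef (Li_partial_split 1) Li_partial_split expr1n mul1r.
by rewrite addrAC subrr add0r mulrC.
Qed.

Lemma Li_coef_ge0 n : 0 <= Li_coef n.
Proof.
rewrite /Li_coef Li_partial_split expr1n mul1r addrAC subrr add0r.
by apply: sumr_ge0 => m _; rewrite invr_ge0 Li_weight_ge0.
Qed.

(** An increasing tuple of k positive integers ends at k or later. *)
Lemma Li_partial_small z N : (N < k)%N -> Lip z N = 0.
Proof.
move=> Nk; rewrite /Li_partial big_pred0// => n; apply/negP => pn.
have := path_ltn_size pn; rewrite size_map size_tuple add0n.
have := mem_last 0%N (vals n); rewrite inE => /orP[/eqP ->|/mapP[j _ ->]].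
  by rewrite leqn0 => /eqP k0; rewrite k0 in Nk.
by move=> kj; have := leq_ltn_trans kj (ltn_ord j); rewrite ltnS leqNgt Nk.
Qed.

Lemma Li_coef_small n : (n.+1 < k)%N -> Li_coef n = 0.
Proof. by move=> nk; rewrite /Li_coef !Li_partial_small ?subrr// ltnW. Qed.

Lemma Li_partialE z N : Lip z N = \sum_(n < N) Li_coef n * z ^+ n.+1.
Proof.
elim: N => [|N IH]; first by rewrite big_ord0 Li_partial_small.
by rewrite Li_partialS IH big_ord_recr.
Qed.

(** As every n_i is at most n_k, z^(n_k) <= q^(k n_k) <= q^(n_1) ... q^(n_k);
    dropping the ordering of the tuple then leaves the k-th power of a single
    sum. Its term at j = 0 is 1 / 0 = 0. *)
Lemma Li_partial_le_prod z q N : 0 <= z -> 0 <= q <= 1 -> z <= q ^+ k ->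
  Lip z N <= (\sum_(j < N.+1) q ^+ j / j%:R) ^+ k.
Proof.
move=> z0 /andP[q0 q1] zq.
have -> : (\sum_(j < N.+1) q ^+ j / j%:R) ^+ k =
    \prod_(i < k) \sum_(j < N.+1) q ^+ j / j%:R.
  by rewrite prodr_const card_ord.
rewrite bigA_distr_bigA /= (reindex (@finfun_of_tuple 'I_N.+1 k)) /=; last first.
  by exists tuple_of_finfun => n _; rewrite ?tuple_of_finfunK ?finfun_of_tupleK.
rewrite /Li_partial big_mkcond /=; apply: ler_sum => n _.
rewrite [leRHS](eq_bigr (fun i => q ^+ tnth n i / (tnth n i)%:R)); last first.
  by move=> i _; rewrite /finfun_of_tuple ffunE.
have a0 (j : 'I_N.+1) : 0 <= q ^+ j / j%:R by rewrite divr_ge0// exprn_ge0.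
case: ifPn => pn; last by apply: prodr_ge0 => i _.
have entry i : (0 < tnth n i)%N /\ (tnth n i <= last 0 (vals n))%N.
  have inn : val (tnth n i) \in vals n by rewrite map_f// mem_tnth.
  split; last by apply: path_ltn_le_last => //; rewrite inE inn orbT.
  by have /allP/(_ _ inn) := order_path_min ltn_trans pn.
rewrite big_split /= -prodfV.
apply: ler_pM; rewrite ?exprn_ge0 ?invr_ge0 ?prodr_ge0//.
- apply: (@le_trans _ _ ((q ^+ k) ^+ last 0%N (vals n))).
    by rewrite lerXn2r ?nnegrE ?exprn_ge0.
  have -> : q ^+ k ^+ last 0%N (vals n) = \prod_(i < k) q ^+ last 0%N (vals n).
    by rewrite exprAC prodr_const card_ord.
  apply: ler_prod => i _; rewrite exprn_ge0//=.
  by rewrite ler_wiXn2l//; case: (entry i).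
- apply: ler_prod => i _; rewrite invr_ge0 exprn_ge0//=.
  have [n0 _] := entry i.
  rewrite lef_pV2 ?posrE ?exprn_gt0 ?ltr0n//.
  by rewrite ler_eXnr// ?ler1n.
Qed.

(** Take q = 1 - e^{-t} / k in [Li_partial_le_prod]. Bernoulli's inequality gives
    q^k >= 1 - e^{-t} >= z, and - ln (1 - q) = t + ln k. *)
Lemma Li_partial_le z t N : 0 <= t -> 0 <= z <= 1 - expR (- t) ->
  Lip z N <= (t + ln k%:R) ^+ k.
Proof.
move=> t0 /andP[z0 zt]; pose T := t + ln k%:R.
have k1 : 1 <= k%:R :> R by rewrite ler1n.
have k0 : 0 < k%:R :> R by rewrite ltr0n.
have T0 : 0 <= T by rewrite addr_ge0// ln_ge0.
have eT : expR (- T) = expR (- t) / k%:R.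
  by rewrite /T opprD expRD expRN expRN lnK ?posrE// -expRN.
have e1 : expR (- T) <= 1 by rewrite expR_le1 oppr_le0.
apply: le_trans (@Li_partial_le_prod z (1 - expR (- T)) N z0 _ _) _.
- by rewrite subr_ge0 e1 lerBlDr lerDl expR_ge0.
- apply: (le_trans zt); apply: le_trans (bernoulli_le k _); last first.
    by rewrite expR_ge0 e1.
  by rewrite eT mulrC divfK// gt_eqF.
rewrite lerXn2r ?nnegrE//; last exact: log_series_le.
apply: sumr_ge0 => j _; rewrite divr_ge0// exprn_ge0// subr_ge0//.
Qed.

(** A single term of the series at z = 1/2 is at most the bound on its partial
    sums. *)
Lemma Li_coef_le : exists2 M, 0 < M & forall n, Li_coef n <= M * 2 ^+ n.
Proof.
pose c : R := (ln 2 + ln k%:R) ^+ k.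
have c0 : 0 <= c by rewrite exprn_ge0// addr_ge0 ?ln_ge0 ?ler1n.
exists (2 * c + 1); first by lra.
move=> n; have h : Lip (2^-1) n.+1 <= c.
  apply: Li_partial_le; first by rewrite ln_ge0 ?ler1n.
  by rewrite expRN lnK ?posrE//; apply/andP; split; lra.
have Lge0 N : 0 <= Lip (2^-1) N.
  by rewrite Li_partialE; apply: sumr_ge0 => i _; rewrite mulr_ge0 ?Li_coef_ge0// exprn_ge0.
rewrite Li_partialS in h.
have {}h : Li_coef n * 2^-1 ^+ n.+1 <= c by have := Lge0 n; lra.
rewrite exprVn ler_pdivrMr ?exprn_gt0// exprS in h.
have p2 : 0 <= 2 ^+ n :> R by rewrite exprn_ge0.
lra.
Qed.

Lemma Li_cvg z : 0 <= z < 1 -> cvgn (Lip z).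
Proof.
case/andP=> z0 z1; pose t := - ln (1 - z).
have zt : 1 - expR (- t) = z by rewrite /t opprK lnK ?posrE ?subr_gt0// subKr.
have t0 : 0 <= t by rewrite oppr_ge0 ln_le0// gerBl.
apply: nondecreasing_is_cvgn.
  apply/nondecreasing_seqP => n; rewrite Li_partialS lerDl.
  by rewrite mulr_ge0 ?Li_coef_ge0// exprn_ge0.
exists ((t + ln k%:R) ^+ k) => _ [N _ <-]; apply: Li_partial_le => //.
by rewrite z0 zt lexx.
Qed.

Lemma Li_le z t : 0 < t -> 0 <= z <= 1 - expR (- t) ->
  0 <= Li v z <= (t + ln k%:R) ^+ k.
Proof.
move=> t0 zt; have zc : cvgn (Lip z).
  apply: Li_cvg; case/andP: zt => -> /le_lt_trans -> //.
  by rewrite ltrBlDr ltrDl expR_gt0.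
case/andP: (zt) => z0 _.
apply/andP; split.
  apply: limr_ge => //; near=> N; rewrite Li_partialE.
  by apply: sumr_ge0 => i _; rewrite mulr_ge0 ?Li_coef_ge0// exprn_ge0.
by apply: limr_le => //; near=> N; apply: Li_partial_le => //; exact: ltW.
Unshelve. all: by end_near. Qed.

End Polylog.

(** * Expansion of the generating function at 0 *)

Section Expansion.
Context {R : realType} (k : nat) (v : k.-tuple nat) (p : R).
Implicit Types (y t z : R) (n m N : nat).
Hypotheses (k_gt0 : (0 < k)%N) (v_gt0 : forall i : 'I_k, (0 < tnth v i)%N).
Hypothesis p_ge1 : 1 <= p.

Let p_gt0 : 0 < p. Proof. exact: lt_le_trans p_ge1. Qed.

(** The coefficient of (1 - e^{-t})^n in e^{-yt} Bgen (y + 1) t. The shift of y by 1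
    absorbs the factor e^t of e^t - 1 = e^t (1 - e^{-t}). *)
Definition alpha n : R := Li_coef v n / p ^+ n.+1.
(** The coefficient of t^m in Bgen (y + 1) t: only the terms with n <= m
    contribute, as (1 - e^{-t})^n vanishes to order n at 0. *)
Definition Ecoef y m : R := \sum_(n < m.+1) alpha n * fdiff n y m.

Lemma alpha_le : exists2 M, 0 < M & forall n, 0 <= alpha n <= M * 2 ^+ n.
Proof.
have [M M0 hM] := @Li_coef_le R k v k_gt0 v_gt0; exists M => // n.
have p1 : 1 <= p ^+ n.+1 by rewrite exprn_ege1.
have c0 : 0 <= Li_coef v n := @Li_coef_ge0 R k v n.
rewrite divr_ge0 ?exprn_ge0 ?(ltW p_gt0)//=; apply: le_trans (hM n).
by rewrite ler_pdivrMr ?exprn_gt0// ler_peMr.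
Qed.

Lemma Ecoef_small y m : (m.+1 < k)%N -> Ecoef y m = 0.
Proof.
move=> mk; rewrite /Ecoef big1// => n _; rewrite /alpha Li_coef_small ?mul0r//.
by apply: leq_ltn_trans mk; exact: ltn_ord.
Qed.

Lemma Ecoef_widen y m N : (m < N)%N ->
  Ecoef y m = \sum_(n < N) alpha n * fdiff n y m.
Proof.
move=> mN; rewrite /Ecoef (big_ord_widen N (fun n => alpha n * fdiff n y m))//.
rewrite big_mkcond; apply: eq_bigr => n _; case: ifPn => //.
by rewrite -leqNgt => mn; rewrite fdiff_small ?mulr0.
Qed.

Lemma Ecoef_shift y m : Ecoef (y - 1) m =
  \sum_(i < m.+1) Ecoef y i * ((-1) ^+ (m - i) / (m - i)`!%:R).
Proof.
rewrite /Ecoef (eq_bigr (fun n : 'I_m.+1 => \sum_(i < m.+1)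
    alpha n * fdiff n y i * ((-1) ^+ (m - i) / (m - i)`!%:R))); last first.
  by move=> n _; rewrite fdiff_shift mulr_sumr; apply: eq_bigr => i _; rewrite mulrA.
rewrite exchange_big; apply: eq_bigr => i _.
by rewrite -mulr_suml; congr (_ * _); rewrite -(Ecoef_widen y (ltn_ord i)).
Qed.

Lemma half_sum_le N : \sum_(n < N) (2^-1 : R) ^+ n <= 2.
Proof.
suff -> : \sum_(n < N) (2^-1 : R) ^+ n = 2 - 2 * 2^-1 ^+ N.
  by rewrite gerBl mulr_ge0// exprn_ge0.
elim: N => [|N IH]; first by rewrite big_ord0 expr0; lra.
by rewrite big_ord_recr /= IH exprS; lra.
Qed.

Lemma expR_small (a : R) : 0 <= a -> a <= 8^-1 -> expR a <= 8 / 7.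
Proof.
move=> a0 a8; have h1 := expR_ge1Dx (- a); have h2 := expRxMexpNx_1 a.
have h3 := expR_gt0 a.
have : expR a * (1 - 8^-1) <= 1.
  rewrite -[leRHS]h2 ler_wpM2l ?expR_ge0//.
  by apply: le_trans h1; lra.
lra.
Qed.

(** Case r = 1/8 of [fdiff_le], as e^{1/8} - 1 <= 1/7 <= 1/4. The ratio 1/4 in n
    beats the growth 2^n of the coefficients [alpha]. *)
Lemma fdiff_bound y n m : `|fdiff n y m| <= expR `|y| * 4^-1 ^+ n * 8 ^+ m.
Proof.
have e8 : expR (8^-1 : R) <= 8 / 7 by apply: expR_small => //; lra.
have := @fdiff_le R n y m 8^-1 ltac:(lra).
rewrite [8^-1 ^+ m]exprVn ler_pdivrMr ?exprn_gt0// => /le_trans; apply.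
rewrite ler_wpM2r ?exprn_ge0//.
have h0 : 0 <= expR (8^-1 : R) - 1 by rewrite subr_ge0 le1_expR invr_ge0.
apply: ler_pM; rewrite ?expR_ge0 ?exprn_ge0//.
  by rewrite ler_expR ler_piMr//; lra.
by rewrite lerXn2r ?nnegrE//; lra.
Qed.

Lemma Ecoef_le y : exists2 K, 0 <= K & forall m, `|Ecoef y m| <= K * 8 ^+ m.
Proof.
have [M M0 hM] := alpha_le; exists (M * expR `|y| * 2).
  by rewrite !mulr_ge0 ?expR_ge0// ltW.
move=> m; rewrite /Ecoef; apply: le_trans (ler_norm_sum _ _ _) _.
apply: (@le_trans _ _ (\sum_(n < m.+1) M * expR `|y| * 8 ^+ m * 2^-1 ^+ n)).
  apply: ler_sum => n _; rewrite normrM.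
  have /andP[a0 a1] := hM n; rewrite (ger0_norm a0).
  apply: le_trans (ler_pM a0 (normr_ge0 _) a1 (fdiff_bound y n m)) _.
  rewrite le_eqVlt; apply/orP; left; apply/eqP.
  rewrite (_ : 2^-1 ^+ n = 2 ^+ n * 4^-1 ^+ n); first by ring.
  by rewrite -exprMn; congr (_ ^+ _); lra.
rewrite -mulr_sumr -[leRHS]mulrA [2 * _]mulrC mulrA ler_wpM2l ?half_sum_le//.
by rewrite !mulr_ge0 ?expR_ge0 ?exprn_ge0// ltW.
Qed.

(** Truncating both the sum over n and the expansions in t at N leaves an error
    of size sum_(n < N) 2^n 4^(-n) (8 |t|)^N, up to a constant, which is
    O(2^(-N)) for |t| <= 1/16. *)
Lemma Bgen_series y t : t != 0 -> `|t| <= 16^-1 ->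
  series (fun m => Ecoef y m * t ^+ m) @ \oo --> Bgen v p (y + 1) t.
Proof.
move=> t0 t16; pose w := 1 - expR (- t); pose z := w / p.
have w8 : `|w| <= 8^-1.
  have [h _ _] := expR_bounds (- t); rewrite distrC normrN in h.
  apply: (le_trans h).
  have := @expR_small `|t| (normr_ge0 _) ltac:(lra).
  have := normr_ge0 t; have := expR_ge0 `|t|; nra.
have wn0 : w != 0.
  rewrite /w subr_eq0 eq_sym -expR0; apply: contraNneq t0 => /expR_inj.
  by move/eqP; rewrite oppr_eq0.
have z8 : `|z| <= 8^-1.
  rewrite normrM normfV (gtr0_norm p_gt0) ler_pdivrMr//; apply: (le_trans w8).
  by rewrite ler_peMr.
have [M M0 hM] := @Li_coef_le R k v k_gt0 v_gt0.
have LiE : Li_partial v z = series (fun n => Li_coef v n * z ^+ n.+1).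
  by apply/funext => N; rewrite Li_partialE// seriesEord.
have LiC : Li_partial v z @ \oo --> Li v z.
  rewrite /Li LiE; apply: normed_cvg.
  apply: (@series_le_cvg _ _ (geometric M 4^-1)) => //.
  - by move=> n; exact: normr_ge0.
  - by move=> n; apply: geometric_ge0; [exact: ltW|rewrite invr_ge0].
  - move=> n; rewrite /geometric /= normrM normrX (ger0_norm (Li_coef_ge0 v n)).
    apply: le_trans (ler_pM (Li_coef_ge0 v n) (exprn_ge0 _ (normr_ge0 z)) (hM n)
      (_ : _ <= 8^-1 ^+ n)) _.
      rewrite exprS; apply: (@le_trans _ _ (1 * 8^-1 ^+ n)); last by rewrite mul1r.
      apply: ler_pM; rewrite ?exprn_ge0//; first by lra.
      by rewrite lerXn2r ?nnegrE.
    by rewrite -mulrA -exprMn ler_wpM2l ?(ltW M0)// lerXn2r ?nnegrE//; lra.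
  - by apply: is_cvg_geometric_series; rewrite ger0_norm//; lra.
pose f n := expR (y * t) * w ^+ n.
pose P N := \sum_(n < N) alpha n * f n.
have PC : P @ \oo --> Bgen v p (y + 1) t.
  rewrite (_ : P = (fun N => expR ((y + 1) * t) / (expR t - 1) * Li_partial v z N)).
    by apply: cvgM; [exact: cvg_cst|exact: LiC].
  apply/funext => N; rewrite /P Li_partialE// mulr_sumr; apply: eq_bigr => n _.
  rewrite /alpha /f /z (mulrDl y 1 t) mul1r expRD.
  have -> : expR t - 1 = expR t * w.
    by rewrite /w mulrBr mulr1 expRxMexpNx_1.
  rewrite expr_div_n [w ^+ n.+1]exprS; field.
  by rewrite wn0 expf_neq0 ?gt_eqF ?expR_gt0.
have diff N : `|P N - series (fun m => Ecoef y m * t ^+ m) N| <=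
    (4 * (M * expR `|y|)) * 2^-1 ^+ N.
  rewrite seriesEord /= (eq_bigr (fun m : 'I_N => \sum_(n < N)
      alpha n * (fdiff n y m * t ^+ m))); last first.
    move=> m _; rewrite (Ecoef_widen y (ltn_ord m)) mulr_suml.
    by apply: eq_bigr => n _; rewrite mulrA.
  rewrite exchange_big /= /P -sumrB; apply: le_trans (ler_norm_sum _ _ _) _.
  apply: (@le_trans _ _ (\sum_(n < N) (2 * (M * expR `|y|)) * 2^-1 ^+ N * 2^-1 ^+ n)); last first.
    rewrite -mulr_sumr; have h2 := half_sum_le N.
    have c0 : 0 <= 2 * (M * expR `|y|) * 2^-1 ^+ N.
      by rewrite !mulr_ge0 ?expR_ge0 ?exprn_ge0 ?(ltW M0).
    by apply: le_trans (ler_wpM2l c0 h2) _; lra.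
  apply: ler_sum => n _; rewrite -mulr_sumr -mulrBr normrM.
  have p1 : 1 <= p ^+ n.+1 by rewrite exprn_ege1.
  have a0 : 0 <= alpha n.
    by rewrite divr_ge0 ?exprn_ge0 ?(ltW p_gt0)// Li_coef_ge0.
  have a1 : alpha n <= M * 2 ^+ n.
    by apply: le_trans (hM n); rewrite ler_pdivrMr ?exprn_gt0// ler_peMr// Li_coef_ge0.
  have K0 : 0 <= expR `|y| * 4^-1 ^+ n by rewrite mulr_ge0 ?expR_ge0// exprn_ge0.
  have tail := @series_tail R _ _ (expR `|y| * 4^-1 ^+ n) 2^-1 N K0 _ _ (@fdiff_series R n y t).
  rewrite (ger0_norm a0); apply: le_trans (ler_pM a0 (normr_ge0 _) a1 (tail _ _)) _.
  - by apply/andP; split; lra.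
  - move=> m; rewrite normrM normrX.
    apply: (@le_trans _ _ (expR `|y| * 4^-1 ^+ n * 8 ^+ m * 16^-1 ^+ m)).
      apply: ler_pM; rewrite ?exprn_ge0 ?fdiff_bound//.
      by rewrite lerXn2r ?nnegrE.
    by rewrite -mulrA -exprMn ler_wpM2l// lerXn2r ?nnegrE//; lra.
  rewrite le_eqVlt; apply/orP; left; apply/eqP.
  rewrite (_ : 2^-1 ^+ n = 2 ^+ n * 4^-1 ^+ n); first by ring.
  by rewrite -exprMn; congr (_ ^+ _); lra.
have diff0 : (fun N => P N - series (fun m => Ecoef y m * t ^+ m) N) @ \oo --> (0 : R).
  apply: cvg0_le diff _.
  rewrite -[X in _ --> X](mulr0 (4 * (M * expR `|y|))); apply: cvgM.
    exact: cvg_cst.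
  by apply: cvg_expr; rewrite ger0_norm//; lra.
rewrite (_ : series _ = P - (fun N => P N - series (fun m => Ecoef y m * t ^+ m) N)).
  by rewrite -[X in _ --> X]subr0; apply: cvgB.
by apply/funext => N; rewrite !fctE subKr.
Qed.

Lemma Bgen_remainder y N : exists2 K, 0 <= K & forall t, 0 < t -> t <= 16^-1 ->
  `|Bgen v p (y + 1) t - \sum_(m < N) Ecoef y m * t ^+ m| <= K * t ^+ N.
Proof.
have [K K0 hK] := Ecoef_le y; exists (2 * K * 8 ^+ N).
  by rewrite !mulr_ge0// exprn_ge0.
move=> t t0 t16.
have -> : 2 * K * 8 ^+ N * t ^+ N = 2 * K * (8 * t) ^+ N by rewrite exprMn mulrA.
have tn0 : t != 0 by rewrite gt_eqF.
have tn16 : `|t| <= 16^-1 by rewrite gtr0_norm.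
have q2 : 0 <= 8 * t <= 2^-1 by apply/andP; split; lra.
have hs := @Bgen_series y _ tn0 tn16.
apply: (@series_tail R _ _ K (8 * t) N K0 q2 _ hs).
by move=> m; rewrite normrM normrX (gtr0_norm t0) exprMn mulrA ler_wpM2r// exprn_ge0// ltW.
Qed.

(** Uniqueness of expansions identifies the sequence chosen in the definition
    of B. *)
Lemma B_Ecoef y m : B v p m (y + 1) = Ecoef y m * m`!%:R.
Proof.
pose b m := Ecoef y m * m`!%:R.
have f0 j : j`!%:R != 0 :> R by rewrite pnatr_eq0 -lt0n fact_gt0.
have near16 : \forall t \near (0 : R)^', t != 0 /\ `|t| <= 16^-1.
  near=> t; split; near: t; first exact: nbhs_dnbhs_neq.
  by apply: dnbhs0_le; rewrite invr_gt0.
have bE : is_Bexpansion v p (y + 1) b.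
  rewrite /is_Bexpansion; apply: filterS near16 => t [t0 t16].
  rewrite (_ : [series _]_m = series (fun m => Ecoef y m * t ^+ m)).
    exact: Bgen_series.
  apply/funext => N; rewrite !seriesEord /=; apply: eq_bigr => j _.
  by rewrite /b; field.
rewrite /B; set P := (X in xget _ X).
have : P (xget (fun=> 0) P) by apply: (@xgetPex _ (fun=> 0) P); exists b.
set b' := xget _ P => b'E.
have /(_ m)/eqP : forall j, (b j - b' j) / j`!%:R = 0.
  apply: pseries_unique; near=> t.
  have h1 : [series b m * (t ^+ m / m`!%:R)]_m @ \oo --> Bgen v p (y + 1) t.
    by near: t; exact: bE.
  have h2 : [series b' m * (t ^+ m / m`!%:R)]_m @ \oo --> Bgen v p (y + 1) t.
    by near: t; exact: b'E.
  rewrite -(subrr (Bgen v p (y + 1) t)).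
  rewrite (_ : series _ = [series b m * (t ^+ m / m`!%:R)]_m -
      [series b' m * (t ^+ m / m`!%:R)]_m); first exact: cvgB.
  apply/funext => N; rewrite !fctE !seriesEord /= -sumrB; apply: eq_bigr => j _.
  by rewrite -mulrBl mulrAC mulrA.
by rewrite mulf_eq0 invr_eq0 (negbTE (f0 m)) orbF subr_eq0 => /eqP <-.
Unshelve. all: by end_near. Qed.

End Expansion.

(** * Analytic continuation *)

Section Continuation.
Context {R : realType} (k : nat) (v : k.-tuple nat) (p x : R).
Local Notation C := R[i].
Local Notation mu := (@lebesgue_measure R).
Local Notation Rpos := (`](0 : R), +oo[%classic : set R).
Local Notation Re := (@complex.Re R).
Local Notation Im := (@complex.Im R).
Local Notation normc := (@Normc.normc R).
Local Notation E := (@Euler_integral R).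
Implicit Types (s z : C) (t b u : R) (N n m : nat).
Hypotheses (k_gt0 : (0 < k)%N) (v_gt0 : forall i : 'I_k, (0 < tnth v i)%N).
Hypotheses (p_ge1 : 1 <= p) (x_gtN1 : 0 < x + 1).

Let p_gt0 : 0 < p. Proof. exact: lt_le_trans p_ge1. Qed.

Local Notation d := (Ecoef v p (- x)).

(** Z is the Mellin transform of this function, divided by Gamma. *)
Definition kern t : R := expR (- (x * t)) / (expR t - 1) * Li v ((1 - expR (- t)) / p).
(** The coefficients are those of e^t times the kernel, so this is O(t^N) at 0
    (see [kern_Bgen]). *)
Definition kern_rem N t : R := kern t - expR (- t) * \sum_(m < N) d m * t ^+ m.

Lemma kern_Bgen t : kern t = expR (- t) * Bgen v p (- x + 1) t.
Proof.
rewrite /kern /Bgen mulrA; congr (_ * _); rewrite mulrA; congr (_ / _).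
by rewrite -expRD; congr expR; ring.
Qed.

Lemma pow_le_expR m b : 0 < b ->
  exists2 K, 0 <= K & forall u, 0 <= u -> u ^+ m <= K * expR (b * u).
Proof.
move=> b0; case: m => [|m].
  by exists 1 => // u u0; rewrite expr0 mul1r le1_expR mulr_ge0// ltW.
have c0 : 0 < m.+1%:R / b by rewrite divr_gt0.
exists ((m.+1%:R / b) ^+ m.+1); first by rewrite exprn_ge0// ltW.
move=> u u0; have -> : expR (b * u) = expR (b * u / m.+1%:R) ^+ m.+1.
  by rewrite -expRM_natl [m.+1%:R * _]mulrC divfK.
rewrite -exprMn lerXn2r ?nnegrE//.
  by apply: mulr_ge0; [exact: ltW|exact: expR_ge0].
rewrite -ler_pdivrMl// invf_div.
apply: le_trans (expR_ge1Dx _); rewrite mulrAC.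
by rewrite lerDr.
Qed.

Lemma zarg_bounds t : 0 < t ->
  0 <= (1 - expR (- t)) / p <= 1 - expR (- t) /\ (1 - expR (- t)) / p < 1.
Proof.
move=> t0; have w0 : 0 <= 1 - expR (- t) by rewrite subr_ge0 expR_le1 oppr_le0 ltW.
have h : (1 - expR (- t)) / p <= 1 - expR (- t).
  by rewrite ler_pdivrMr// ler_peMr.
split; first by rewrite divr_ge0 ?(ltW p_gt0).
by apply: (le_lt_trans h); rewrite ltrBlDr ltrDl expR_gt0.
Qed.

Lemma measurable_kern : measurable_fun Rpos kern.
Proof.
apply: measurable_funM.
  apply: continuous_halfline_measurable => t t0.
  apply: continuousM.
    apply: continuous_comp; last exact: continuous_expR.
    apply: continuousN; apply: continuousM => //; exact: cst_continuous.
  apply: continuousV.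
    by rewrite subr_eq0 gt_eqF// expR_gt1.
  by apply: continuousB; [exact: continuous_expR|exact: cst_continuous].
apply: (measurable_fun_cvg (h := fun N t => Li_partial v ((1 - expR (- t)) / p) N)).
- move=> N; apply: measurable_funTS.
  rewrite (_ : (fun t => _) = (fun t => \sum_(n < N) Li_coef v n *
      ((1 - expR (- t)) / p) ^+ n.+1)); last first.
    by apply/funext => t; rewrite Li_partialE.
  apply: measurable_sum => n; apply: measurable_funM => //.
  apply: measurable_funX; apply: continuous_measurable_fun => t.
  apply: cvgM; last exact: cvg_cst.
  apply: cvgB; first exact: cvg_cst.
  by apply: continuous_comp; [exact: opp_continuous|exact: continuous_expR].
- move=> t; rewrite /= in_itv /= andbT => t0.
  have [/andP[z0 _] z1] := zarg_bounds t0.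
  by apply: Li_cvg => //; rewrite z0 z1.
Qed.

Let b := (x + 1) / 2.
Let b_gt0 : 0 < b. Proof. by rewrite divr_gt0. Qed.

(** The denominator e^t - 1 contributes e^{-t}, so the kernel is bounded by e^{-(x+1)t}
    up to a polynomial factor; half of the exponent absorbs that factor. *)
Lemma kern_large : exists2 K, 0 <= K &
  forall t, 16^-1 <= t -> `|kern t| <= K * expR (- (b * t)).
Proof.
have [K K0 hK] := pow_le_expR k b_gt0.
pose L := ln k%:R : R; pose e := expR (- 16^-1) : R.
have L0 : 0 <= L by rewrite ln_ge0// ler1n.
have e1 : 0 < 1 - e by rewrite subr_gt0 expR_lt1 oppr_lt0 invr_gt0.
exists ((1 - e)^-1 * (K * expR (b * L))).
  by rewrite !mulr_ge0 ?expR_ge0// invr_ge0 ltW.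
move=> t t16; have t0 : 0 < t by apply: lt_le_trans t16; rewrite invr_gt0.
have [zb _] := zarg_bounds t0.
have /andP[li0 li1] := Li_le k_gt0 v_gt0 t0 zb.
have et : 0 < expR t - 1 by rewrite subr_gt0 expR_gt1.
rewrite /kern ger0_norm; last first.
  by rewrite !mulr_ge0 ?expR_ge0 ?invr_ge0 ?(ltW et).
have h1 : (expR t - 1)^-1 <= (1 - e)^-1 * expR (- t).
  rewrite expRN -invfM lef_pV2 ?posrE ?mulr_gt0 ?expR_gt0//.
  rewrite mulrBl mul1r lerD2l lerN2 -expRD le1_expR.
  by rewrite addrC subr_ge0.
have h2 : Li v ((1 - expR (- t)) / p) <= K * expR (b * L) * expR (b * t).
  apply: (le_trans li1); apply: le_trans (hK _ _) _; first by rewrite addr_ge0// ltW.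
  by rewrite mulrDr expRD -mulrA [expR (b * t) * _]mulrC.
have p1 : 0 <= expR (- (x * t)) / (expR t - 1).
  by rewrite divr_ge0 ?expR_ge0// ltW.
apply: le_trans (ler_pM p1 li0 _ h2) _.
  apply: ler_wpM2l h1; exact: expR_ge0.
rewrite le_eqVlt; apply/orP; left; apply/eqP.
rewrite [expR (- (b * t))](_ : _ = expR (- (x * t)) * expR (- t) * expR (b * t)).
  by ring.
by rewrite -!expRD; congr expR; rewrite /b; lra.
Qed.

Lemma poly_large (a : nat -> R) N : exists2 K, 0 <= K &
  forall t, 0 <= t -> `|\sum_(m < N) a m * t ^+ m| <= K * expR (2^-1 * t).
Proof.
elim: N => [|N [K K0 IH]].
  by exists 0 => // t t0; rewrite big_ord0 normr0 mul0r.
have [K' K'0 hK'] := @pow_le_expR N 2^-1 ltac:(lra).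
exists (K + `|a N| * K'); first by rewrite addr_ge0// mulr_ge0.
move=> t t0; rewrite big_ord_recr /=; apply: le_trans (ler_normD _ _) _.
rewrite mulrDl lerD ?IH// normrM -mulrA ler_wpM2l// ger0_norm ?exprn_ge0//.
exact: hK'.
Qed.

(** Near 0 this is the remainder of the expansion; away from 0 the kernel and
    the subtracted terms decay separately, and t^N is bounded below. *)
Lemma kern_rem_of_order N : of_order N (kern_rem N).
Proof.
split.
  apply: measurable_funB; first exact: measurable_kern.
  apply: measurable_funTS; apply: measurable_funM.
    apply: continuous_measurable_fun => t.
    by apply: continuous_comp; [exact: opp_continuous|exact: continuous_expR].
  apply: measurable_sum => m; apply: measurable_funM => //.
have [K1 K10 h1] := Bgen_remainder k_gt0 v_gt0 p_ge1 (- x) N.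
have [K2 K20 h2] := kern_large.
have [K3 K30 h3] := poly_large d N.
pose be := Num.min b 2^-1.
have be0 : 0 < be by rewrite lt_min b_gt0 /= invr_gt0 ltr0n.
have beb : be <= b by rewrite ge_min lexx.
have be2 : be <= 2^-1 by rewrite ge_min lexx orbT.
have wE t : 0 < t -> weight N%:R be t = t ^+ N * expR (- (be * t)).
  by move=> t0; rewrite /weight expRD expRM_natl lnK.
exists (K1 * expR be + (K2 + K3) * 16 ^+ N), be; split => // t t0.
rewrite wE// mulrDl.
have q1 : 0 <= K1 * expR be * (t ^+ N * expR (- (be * t))).
  by rewrite !mulr_ge0 ?expR_ge0 ?exprn_ge0// ltW.
have q2 : 0 <= (K2 + K3) * 16 ^+ N * (t ^+ N * expR (- (be * t))).
  by rewrite !mulr_ge0 ?addr_ge0 ?expR_ge0 ?exprn_ge0// ltW.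
have [t16|/ltW t16] := leP t 16^-1.
  apply: (@le_trans _ _ (K1 * expR be * (t ^+ N * expR (- (be * t))))); last first.
    by rewrite lerDl.
  rewrite /kern_rem kern_Bgen -mulrBr normrM ger0_norm ?expR_ge0//.
  rewrite (_ : K1 * _ * _ = expR (be - be * t) * (K1 * t ^+ N)); last first.
    by rewrite expRD; ring.
  apply: ler_pM (h1 t t0 t16); rewrite ?expR_ge0// ler_expR.
  have : be * t <= be * 1 by rewrite ler_wpM2l ?(ltW be0)//; lra.
  by rewrite mulr1; lra.
apply: (@le_trans _ _ ((K2 + K3) * 16 ^+ N * (t ^+ N * expR (- (be * t))))); last first.
  by rewrite lerDr.
rewrite mulrA -[(K2 + K3) * _ * _]mulrA -exprMn.
have T1 : 1 <= (16 * t) ^+ N by rewrite exprn_ege1//; lra.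
apply: (@le_trans _ _ ((K2 + K3) * expR (- (be * t)))); last first.
  by rewrite ler_wpM2r ?expR_ge0// ler_peMr// addr_ge0.
rewrite mulrDl; apply: le_trans (ler_normB _ _) _; apply: lerD.
  apply: le_trans (h2 t t16) _; rewrite ler_wpM2l// ler_expR lerN2.
  by rewrite ler_wpM2r// ltW.
rewrite normrM ger0_norm ?expR_ge0//.
apply: le_trans (ler_wpM2l (expR_ge0 _) (h3 t (ltW t0))) _.
rewrite mulrCA ler_wpM2l// -expRD ler_expR.
have : be * t <= 2^-1 * t by rewrite ler_wpM2r// ltW.
lra.
Qed.

Definition rising s m : C := \prod_(i < m) (s + i%:R).
(** The summand of index m is 1/Gamma times the Mellin transform of d_m t^m e^{-t},
    in the polynomial form that makes sense for every s. *)
Definition Zcont_level N s : C :=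
  rGamma N s * mellin (kern_rem N) s + \sum_(m < N) (d m)%:C * rising s m.

(** The difference of two successive remainders is d_N t^N e^{-t}, whose Mellin
    transform is d_N Gamma(s + N). *)
Lemma mellin_kern_remS N s : 0 < Re s + N%:R ->
  mellin (kern_rem N.+1) s = mellin (kern_rem N) s - (d N)%:C * E (s + N%:R).
Proof.
move=> sN; have sN' : - N%:R < Re s by rewrite -subr_gt0 opprK.
have sN0 : - 0%:R < Re (s + N%:R) by rewrite oppr0 ReD Re_nat.
have i1 := mellin_cintegrable (kern_rem_of_order N) sN'.
have i2 := mellin_cintegrable of_order_expRN sN0.
have [i3 e3] := cintegrableZ (- (d N)%:C) i2.
have [_ e4] := cintegrableD i1 i3.
rewrite /mellin -mulNr -[E _]/(cintegral Rpos (mellin_integrand _ _)) -e3 -e4.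
apply: eq_cintegral => t t0; rewrite /mellin_integrand.
rewrite [s + N%:R - 1]addrAC (cpowD (s - 1) N%:R t0) cpow_nat//.
rewrite /kern_rem big_ord_recr /=.
set S := \sum_(m < N) _; set c := cpow t _.
rewrite mulrDr opprD addrA rmorphD mulrDl; congr (_ + _).
by rewrite rmorphN !rmorphM /=; ring.
Qed.

(** The change in the first term is compensated by the new summand, since
    Gamma(s + N) / Gamma(s) = s(s+1)...(s+N-1). *)
Lemma Zcont_levelS N s : 0 < Re s + N%:R -> Zcont_level N.+1 s = Zcont_level N s.
Proof.
move=> sN; rewrite /Zcont_level rGammaS// mellin_kern_remS// mulrBr big_ord_recr /=.
have := rGamma_Euler sN sN; rewrite -/(rising s N) => <-.
by ring.
Qed.

Lemma Zcont_level_indep N m s : 0 < Re s + N%:R -> 0 < Re s + m%:R ->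
  Zcont_level N s = Zcont_level m s.
Proof.
wlog Nm : N m / (N <= m)%N.
  move=> H; case: (leqP N m) => [/H//|/ltnW mN] h1 h2.
  by rewrite [RHS](H m N mN).
move=> h1 _; rewrite -(subnKC Nm); elim: (m - N)%N => [|j IH]; first by rewrite addn0.
by rewrite addnS Zcont_levelS// natrD addrA ltr_wpDr.
Qed.

Lemma holo_Zcont_level N s : 0 < Re s + N%:R -> holo (Zcont_level N) s.
Proof.
move=> sN; apply: holoD.
  apply: holoM; first exact: holo_rGamma.
  apply: (mellin_derivable (kern_rem_of_order N)).
  by rewrite -subr_gt0 opprK.
apply: holo_sum => m; apply: holoM; first exact: holo_cst.
by apply: holo_prod => i; apply: holoD; [exact: holo_id|exact: holo_cst].
Qed.

Definition level s : nat := (Num.truncn `|Re s|).+1.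
Definition Zcont s : C := Zcont_level (level s) s.

Lemma level_gt s : 0 < Re s + (level s)%:R.
Proof.
have h : `|Re s| < (level s)%:R by exact: truncnS_gt.
by have := ler_norm (- Re s); rewrite normrN; lra.
Qed.

Lemma ZcontE N s : 0 < Re s + N%:R -> Zcont s = Zcont_level N s.
Proof. by move=> sN; apply: Zcont_level_indep => //; exact: level_gt. Qed.

(** Although [level] jumps, near s the function is given by the fixed formula
    of level [level s]. *)
Lemma entire_Zcont : entire Zcont.
Proof.
move=> s; have sN := level_gt s; apply: (holo_near sN _ (holo_Zcont_level sN)) => z zs.
apply/esym/ZcontE; have := le_Re_normc (z - s).
move/le_lt_trans/(_ zs); rewrite ReD ReN ltr_norml => /andP[h _].
by move: h; lra.
Qed.

Lemma kern_rem_small t : kern_rem k.-1 t = kern t.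
Proof.
rewrite /kern_rem big1 ?mulr0 ?subr0// => m _; rewrite Ecoef_small ?mul0r//.
by rewrite -ltn_predRL ltn_ord.
Qed.

(** At level k - 1 there is nothing to subtract. *)
Lemma Zcont_domain s : 1 - k%:R < Re s ->
  cintegrable Rpos (Zintegrand v p x s) /\ Zcont s = Z v p s x.
Proof.
move=> sk; have kE : k%:R = k.-1%:R + 1 :> R by rewrite natr1 prednK.
have sk' : 0 < Re s + k.-1%:R by move: sk; rewrite kE; lra.
have sk2 : - k.-1%:R < Re s by move: sk'; lra.
have rk : kern_rem k.-1 = kern by apply/funext => t; exact: kern_rem_small.
have hi := mellin_cintegrable (kern_rem_of_order k.-1) sk2.
split; first by move: hi; rewrite rk.
rewrite (ZcontE sk') /Zcont_level rk big1 ?addr0; last first.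
  move=> m _; rewrite Ecoef_small ?mul0r//.
  by rewrite -ltn_predRL ltn_ord.
by rewrite /Z (Gamma_inv sk').
Qed.

Lemma rising_neg m j : (j <= m)%N ->
  rising (- m%:R) j = ((-1) ^+ j * m`!%:R / (m - j)`!%:R)%:C.
Proof.
move=> jm; have f0 i : i`!%:R != 0 :> R by rewrite pnatr_eq0 -lt0n fact_gt0.
have -> : (-1) ^+ j * m`!%:R / (m - j)`!%:R = (-1) ^+ j * (m ^_ j)%:R :> R.
  by rewrite -(ffact_fact jm) natrM mulrA mulfK.
elim: j jm => [|j IH] jm; first by rewrite /rising big_ord0 ffactn0 mulr1.
rewrite /rising big_ord_recr /= -/(rising _ _) IH; last exact: ltnW.
rewrite ffactnSr natrM natrB; last exact: ltnW.
rewrite exprS !rmorphM rmorphB /= !rmorph_nat !rmorphXn /= rmorphN1.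
by ring.
Qed.

(** 1/Gamma vanishes at -m, and the remaining finite sum is the Cauchy product of
    the coefficients with those of e^{-t}, since
    (-m)(-m+1)...(-m+j-1) = (-1)^j m! / (m-j)!. *)
Lemma Zcont_neg m : Zcont (- m%:R) = (-1) ^+ m * (B v p m (- x))%:C.
Proof.
have mp : 0 < Re (- m%:R) + m.+1%:R by rewrite ReN Re_nat -natr1 addrA addNr add0r.
rewrite (ZcontE mp) /Zcont_level rGamma_neg// mul0r add0r.
have -> : B v p m (- x) = Ecoef v p (- x - 1) m * m`!%:R.
  by rewrite -(B_Ecoef k_gt0 v_gt0 p_ge1) subrK.
rewrite Ecoef_shift mulr_suml rmorph_sum mulr_sumr; apply: eq_bigr => j _.
have jm : (j <= m)%N by rewrite -ltnS.
have -> : (-1) ^+ m = ((-1) ^+ m)%:C :> C by rewrite rmorphXn rmorphN1.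
rewrite rising_neg// -!rmorphM; congr (_%:C).
have -> : (-1) ^+ m = (-1) ^+ j * (-1) ^+ (m - j) :> R by rewrite -exprD subnKC.
have s1 : (-1) ^+ (m - j) * (-1) ^+ (m - j) = 1 :> R by rewrite -expr2 sqrr_sign.
rewrite [RHS](_ : _ = d j * ((-1) ^+ j * m`!%:R / (m - j)`!%:R) *
  ((-1) ^+ (m - j) * (-1) ^+ (m - j))); first by rewrite s1 mulr1.
by ring.
Qed.

End Continuation.

Theorem proposition3 (R : realType) (k : nat) (v : k.-tuple nat) (p x : R)
    (k_gt0 : (0 < k)%N) (v_gt0 : forall i : 'I_k, (0 < tnth v i)%N)
    (p_ge1 : 1 <= p) (x_gtN1 : 0 < x + 1) :
  (forall s : R[i], 1 - k%:R < complex.Re s ->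
     cintegrable `]0, +oo[ (Zintegrand v p x s)) /\
  exists F : R[i] -> R[i],
    [/\ entire F,
        forall s : R[i], 1 - k%:R < complex.Re s -> F s = Z v p s x
      & forall m : nat, F (- m%:R) = (-1) ^+ m * (B v p m (- x))%:C].
Proof.
split=> [s sk|]; first by have [] := Zcont_domain k_gt0 v_gt0 p_ge1 x_gtN1 sk.
exists (Zcont v p x); split.
- exact: entire_Zcont.
- by move=> s sk; have [] := Zcont_domain k_gt0 v_gt0 p_ge1 x_gtN1 sk.
- exact: Zcont_neg.
Qed.
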